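(* Let $\phi\in\mathcal{C}$ be either nondecreasing and convex, or even and convex. Then for every $x\in\mathbb{R}$, all $a_1,a_2\in\mathcal{M}$ with $a_1\leq a_2$ pointwise on $[0,1]$, and all $\alpha\in[0,1]$, $$P_{\phi,x}(\alpha a_1+(1-\alpha)a_2)\leq\alpha P_{\phi,x}(a_1)+(1-\alpha)P_{\phi,x}(a_2).$$
   Context: $\mathcal{C}$ is the collection of all twice differentiable functions $\phi:\mathbb{R}\to\mathbb{R}$ with $\|\phi'\|_\infty<\infty$ and $\|\phi''\|_\infty<\infty$. $\mathcal{M}$ is the collection of all nonincreasing, left-continuous functions $a:[0,1]\to[0,1]$. For $\phi\in\mathcal{C}$ and $a\in\mathcal{M}$, $F_{\phi,a}$ denotes the solution of $$\partial_tF_{\phi,a}(x,t)=\tfrac12\left(\partial_{xx}F_{\phi,a}(x,t)+a(t)(\partial_xF_{\phi,a}(x,t))^2\right),\quad (x,t)\in\mathbb{R}\times[0,1],\qquad F_{\phi,a}(x,0)=\phi(x),$$ in the following sense. If $a\in\mathcal{M}$ is a step function, equal to $m_j$ on $(t_j,t_{j+1}]$ for $0\le j\le k$ with $0=t_0<t_1<\dots<t_{k+1}=1$, then $F_{\phi,a}$ is given recursively by $F_{\phi,a}(x,0)=\phi(x)$ and $$F_{\phi,a}(x,t)=\frac{1}{m_j}\log\mathbb{E}\exp\left(m_jF_{\phi,a}(x+\sqrt{t-t_j}\,z,t_j)\right),\quad t\in(t_j,t_{j+1}],$$ where $z$ is a standard Gaussian random variable (the right-hand side is read as $\mathbb{E}F_{\phi,a}(x+\sqrt{t-t_j}\,z,t_j)$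 when $m_j=0$). On step functions, $a\mapsto F_{\phi,a}(x,t)$ is Lipschitz with respect to the $L^1([0,1])$ norm, uniformly in $(x,t)\in\mathbb{R}\times[0,1]$, and for general $a\in\mathcal{M}$, $F_{\phi,a}(x,t)$ is defined as the limit of $F_{\phi,a_k}(x,t)$ along step functions $a_k\in\mathcal{M}$ with $a_k\to a$ in $L^1([0,1])$. The Parisi functional is $P_{\phi,x}(a):=F_{\phi,a}(x,1)$ for $a\in\mathcal{M}$, $x\in\mathbb{R}$. *)

(* Defs.v *)
From HB Require Import structures.
From mathcomp Require Import all_boot all_order all_algebra.
From mathcomp Require Import all_classical all_reals all_analysis.

Set Implicit Arguments.
Unset Strict Implicit.
Unset Printing Implicit Defensive.

Import Order.TTheory GRing.Theory Num.Theory.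
Import numFieldNormedType.Exports.

Local Open Scope classical_set_scope.
Local Open Scope ring_scope.

(* Twice differentiability, not C^2.  Boundedness of the everywhere defined derivatives is stated
   as a bound at every point. *)
Definition initial_class (R : realType) (phi : R -> R) : Prop :=
  [/\ forall x, derivable phi x 1,
      forall x, derivable (derive1 phi) x 1,
      [bounded derive1 phi x | x in setT] &
      [bounded derive1 (derive1 phi) x | x in setT]].

(* A function on [0, 1] is represented by a function on R, of
   which only the values on [0, 1] are constrained; left-continuity is void at
   the left endpoint. *)
Definition parameter_class (R : realType) (a : R -> R) : Prop :=
  [/\ forall t, t \in `[0, 1] -> a t \in `[0, 1],
      {in `[0, 1] &, forall s t, s <= t -> a t <= a s} &
      forall t, t \in `]0, 1] -> a s @[s --> t^'-] --> a t].

Definition gaussian_mean (R : realType) (g : R -> R) : R :=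
  fine ('E_(normal_prob (0 : R) 1)[g])%E.

(* One step of the recursion: (1 / m) log E exp (m f (x + sqrt d z)), z being a
   standard Gaussian, read as E f (x + sqrt d z) when m = 0. *)
Definition parisi_step (R : realType) (m d : R) (f : R -> R) (x : R) : R :=
  if m == 0 then gaussian_mean (fun z => f (x + Num.sqrt d * z))
  else m^-1 * ln (gaussian_mean (fun z => expR (m * f (x + Num.sqrt d * z)))).

(* The partition is tt 0 = 0 < tt 1 < ... < tt k.+1 = 1, and a is equal to m j
   on ]tt j, tt j.+1] for j <= k. *)
Definition step_decomposition (R : realType) (a : R -> R)
    (k : nat) (tt m : nat -> R) : Prop :=
  [/\ tt 0%N = 0, tt k.+1 = 1,
      forall j, (j <= k)%N -> tt j < tt j.+1 &
      forall j, (j <= k)%N -> forall t, t \in `]tt j, tt j.+1] -> a t = m j].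

(* F is a recursively defined solution for the step function a; F is determined
   on R * [0, 1] only. *)
Definition step_solution (R : realType) (phi a : R -> R) (F : R -> R -> R) :
    Prop :=
  exists (k : nat) (tt m : nat -> R),
    [/\ step_decomposition a k tt m,
        forall x, F x 0 = phi x &
        forall j, (j <= k)%N -> forall t, t \in `]tt j, tt j.+1] ->
          forall x, F x t = parisi_step (m j) (t - tt j) (F ^~ (tt j)) x].

Definition L1_cvg (R : realType) (b : nat -> R -> R) (a : R -> R) : Prop :=
  (\int[@lebesgue_measure R]_(t in `[0%R, 1%R]) (`|b n t - a t|%:E))%E
    @[n --> \oo] --> 0%E.

(* l is the limit of F_{phi, b n}(x, t) along every sequence of step functions
   b n in parameter_class converging to a in L^1([0, 1]).  Constant sequences are
   allowed, so for a step function a in parameter_class such an l is the value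
   given by the recursion. *)
Definition parisi_limit (R : realType) (phi a : R -> R) (x t l : R) : Prop :=
  forall (b : nat -> R -> R) (F : nat -> R -> R -> R),
    (forall n, parameter_class (b n)) ->
    (forall n, step_solution phi (b n) (F n)) ->
    L1_cvg b a ->
    F n x t @[n --> \oo] --> l.

(* F_{phi, a}(x, t), with an arbitrary value where the limit does not exist
   (which never happens for phi in initial_class, a in parameter_class and
   t in [0, 1]). *)
Definition parisi_solution (R : realType) (phi a : R -> R) (x t : R) : R :=
  get [set l | parisi_limit phi a x t l].

Definition parisi_functional (R : realType) (phi : R -> R) (x : R)
    (a : R -> R) : R :=
  parisi_solution phi a x 1.

(* Main.v *)
Require Import Defs.
From HB Require Import structures.
From mathcomp Require Import all_boot all_order all_algebra.
From mathcomp Require Import all_classical all_reals all_analysis.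
From mathcomp Require Import measurable_realfun ring lra.

Set Implicit Arguments.
Unset Strict Implicit.
Unset Printing Implicit Defensive.

Import Order.TTheory GRing.Theory Num.Theory.
Import numFieldNormedType.Exports.

Local Open Scope classical_set_scope.
Local Open Scope ring_scope.

(** Write [P a x] for the Parisi functional. It is the value of a control
    problem,

      P a x = sup_u E[phi (x + int a u ds + W) - (1/2) int a u^2 ds],

    where [W] is a Brownian path, [u] ranges over adapted controls and [a] is
    read backwards in time. For a fixed [u] the point at which [phi] is evaluated
    is affine in [(a, x)] and the running cost is linear in [a]; hence if [phi] is
    convex, the bracket is jointly convex in [(a, x)], and so is the supremum.

    No stochastic calculus is needed to carry this out, because along a step
    function the control problem can be solved one short step at a time. Over a
    step of length [d] with parameter [m], translating the Gaussian variable and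
    Jensen's inequality give, for every slope [u],

      E f (x + m u d + sqrt d z) - m u^2 d / 2 <= parisi_step m d f x

    ([parisi_step_lower]); with [u] a subgradient of [f] at [x] the two sides
    differ by [O(d^2)] ([parisi_step_upper]). Using the slope of [f] as a common
    control for [f1] and [f2], an inequality

      f (al x1 + be x2) <= al f1 x1 + be f2 x2 + eps

    survives one step with parameters [m], [m1], [m2], up to an error
    [O(d^2) + O(|m - (al m1 + be m2)| d)] ([parisi_step_joint]). The second-order
    bound requires [f] to be Lipschitz, convex and semiconcave, all of which are
    preserved by the recursion ([parisi_step_regular]).

    By the semigroup property of the Gaussian steps ([parisi_step_semigroup]) a
    step may be cut into arbitrarily short ones, so the errors [O(d^2)] add up to
    nothing and only the mismatch of the parameters remains
    ([parisi_comparison]). For [al = 1] and [be = 0] this is the Lipschitz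
    continuity in [L^1] which makes the functional well defined on all
    parameters ([step_solution_dist], [parisi_limit_exists]); for
    [a = al a1 + be a2] it is joint convexity on step functions
    ([step_solution_joint_convex]). Evaluating a parameter on a grid commutes
    with convex combinations, so joint convexity passes to the limit
    ([parisi_functional_convex]). *)

(** * Gaussian integrals *)

(** The density is the Radon-Nikodym derivative, up to a null set. *)
Lemma ge0_integral_normal_prob (R : realType) (m s : R) (f : R -> \bar R) :
  measurable_fun [set: R] f -> (forall z, 0 <= f z)%E ->
  (\int[normal_prob m s]_z f z =
   \int[@lebesgue_measure R]_z (f z * (normal_pdf m s z)%:E))%E.
Proof.
move=> mf f0; have dom := normal_prob_dominates m s.
rewrite -(Radon_Nikodym_SigmaFinite.change_of_variables dom)//.
have iRN := Radon_Nikodym_SigmaFinite.f_integrable dom.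
have mRN := measurable_int _ iRN.
have mpdf : measurable_fun [set: R] (EFin \o normal_pdf m s).
  by apply/measurable_EFinP; exact: measurable_normal_pdf.
apply: ae_eq_integral => //; [exact: emeasurable_funM..|].
apply: ae_eqe_mul2l; apply: integral_ae_eq => // A _ mA.
by rewrite -Radon_Nikodym_SigmaFinite.f_integral.
Qed.

Lemma continuous_affine (R : realType) (x s : R) (f : R -> R) :
  continuous f -> continuous (fun z => f (x + s * z)).
Proof.
move=> cf z; apply: (@continuous_comp _ _ _ (fun z : R => x + s * z) f).
  by apply: cvgD; [exact: cvg_cst|apply: cvgM; [exact: cvg_cst|exact: cvg_id]].
exact: cf.
Qed.

Lemma ge0_integral_gauss_affine (R : realType) (x s : R) (f : R -> R) :
  0 < s -> continuous f -> (forall y, 0 <= f y) ->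
  (\int[normal_prob (0 : R) 1]_z (f (x + s * z))%:E =
   \int[@lebesgue_measure R]_y (f y * normal_pdf x s y)%:E)%E.
Proof.
move=> s0 cf f0; pose F := fun z : R => x + s * z.
have dF (z : R) : is_derive z 1 (F : R -> R) s.
  apply: (@is_derive_eq R R R F z 1 _ _
    (is_deriveD (is_derive_cst x z 1) (is_deriveZ s (is_derive_id z 1)))).
  by rewrite add0r /GRing.scale/= mulr1.
have F'E : derive1 F = cst s.
  by apply/funext => z; rewrite derive1E; exact: derive_val.
rewrite ge0_integral_normal_prob; last 2 first.
- apply/measurable_EFinP; apply: continuous_measurable_fun.
  exact: continuous_affine.
- by move=> z; rewrite lee_fin.
rewrite (@increasing_ge0_integration_by_substitutionT R F
  (fun y => f y * normal_pdf x s y)); first last.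
- by move=> y; rewrite mulr_ge0// normal_pdf_ge0.
- move=> y; apply: cvgM; first exact: cf.
  by apply: continuous_normal_pdf; rewrite gt_eqF.
- rewrite /F; under eq_fun do rewrite addrC mulrC.
  by apply: (cvg_comp _ _ _ (cvg_addrr x)); apply: gt0_cvgMly.
- rewrite /F; under eq_fun do rewrite addrC mulrC.
  by apply: (cvg_comp _ _ _ (cvg_addrr_Ny x)); apply: gt0_cvgMlNy.
- by move=> z; case: (dF z).
- by rewrite F'E; exact: is_cvg_cst.
- by rewrite F'E; exact: is_cvg_cst.
- by rewrite F'E => ?; exact: cvg_cst.
- by move=> y z yz; rewrite /F ltrD2l ltr_pM2l.
apply: eq_integral => z _; rewrite -EFinM; congr EFin.
rewrite F'E !fctE -mulrA; congr (_ * _); rewrite /F.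
have s1 : s != 0 by rewrite gt_eqF.
rewrite !normal_pdfE ?oner_neq0// /normal_fun /normal_peak.
rewrite (_ : - (x + s * z - x) ^+ 2 / (s ^+ 2 *+ 2) =
    - (z - 0) ^+ 2 / (1 ^+ 2 *+ 2)); last first.
  by field.
rewrite [RHS]mulrAC; congr (_ * _).
rewrite expr1n mul1r -mulrnAr sqrtrM ?sqr_ge0// sqrtr_sqr gtr0_norm//.
by rewrite invfM mulrAC mulVf// mul1r.
Qed.

Lemma ge0_integral_gauss_shift (R : realType) (c : R) (h : R -> R) :
  continuous h -> (forall y, 0 <= h y) ->
  (\int[normal_prob (0 : R) 1]_z (expR (c * z) * h z)%:E =
   (expR (c ^+ 2 / 2))%:E * \int[normal_prob (0 : R) 1]_z (h (z + c))%:E)%E.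
Proof.
move=> ch h0.
have -> : (\int[normal_prob (0 : R) 1]_z (h (z + c))%:E =
    \int[normal_prob (0 : R) 1]_z (h (c + 1 * z))%:E)%E.
  by apply: eq_integral => z _; rewrite mul1r addrC.
rewrite ge0_integral_gauss_affine// -ge0_integralZl//; first last.
- by move=> y _; rewrite lee_fin mulr_ge0// normal_pdf_ge0.
- apply/measurable_EFinP; apply: measurable_funM; first exact: continuous_measurable_fun.
  exact: measurable_normal_pdf.
rewrite ge0_integral_normal_prob; first last.
- by move=> z; rewrite lee_fin mulr_ge0// expR_ge0.
- apply/measurable_EFinP; apply: continuous_measurable_fun => z.
  apply: cvgM; last exact: ch.
  apply: continuous_comp; last exact: continuous_expR.
  by apply: cvgM; [exact: cvg_cst|exact: cvg_id].
apply: eq_integral => z _; rewrite -!EFinM; congr EFin.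
rewrite !normal_pdfE ?oner_neq0// /normal_fun.
have E : expR (c * z) * expR (- (z - 0) ^+ 2 / (1 ^+ 2 *+ 2)) =
    expR (c ^+ 2 / 2) * expR (- (z - c) ^+ 2 / (1 ^+ 2 *+ 2)).
  by rewrite -!expRD; congr expR; rewrite expr1n; lra.
transitivity (h z * normal_peak 1 *
  (expR (c * z) * expR (- (z - 0) ^+ 2 / (1 ^+ 2 *+ 2)))); first by ring.
by rewrite E; ring.
Qed.

(** Completing the square: conditionally on the endpoints of a Gaussian path,
    the midpoint is Gaussian. *)
Lemma normal_pdf_bridge (R : realType) (x w p q y : R) : 0 < p -> 0 < q ->
  normal_pdf y (Num.sqrt p) w * normal_pdf x (Num.sqrt q) y =
  normal_pdf x (Num.sqrt (p + q)) w *
  normal_pdf ((q * w + p * x) / (p + q)) (Num.sqrt (p * q / (p + q))) y.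
Proof.
move=> p0 q0; have pq0 : 0 < p + q by rewrite addr_gt0.
have r0 : 0 < p * q / (p + q) by rewrite divr_gt0// mulr_gt0.
rewrite !normal_pdfE ?gt_eqF ?sqrtr_gt0// /normal_peak /normal_fun.
rewrite !sqr_sqrtr ?(ltW p0) ?(ltW q0) ?(ltW pq0) ?(ltW r0)//.
rewrite [LHS]mulrACA [RHS]mulrACA -!expRD -!invfM -!sqrtrM; last 2 first.
- by rewrite mulrn_wge0// mulr_ge0 ?pi_ge0// ltW.
- by rewrite mulrn_wge0// mulr_ge0 ?pi_ge0// ltW.
have pqn : p + q != 0 by rewrite gt_eqF.
have pn : p != 0 by rewrite gt_eqF.
have qn : q != 0 by rewrite gt_eqF.
congr ((Num.sqrt _)^-1 * expR _); first by field.
by field; rewrite pn qn pqn.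
Qed.

(** Tonelli's theorem reduces the claim to the composition of the transition
    densities, which [normal_pdf_bridge] integrates out. *)
Lemma ge0_gauss_semigroup (R : realType) (x p q : R) (g : R -> R) :
  0 < p -> 0 < q -> continuous g -> (forall y, 0 <= g y) ->
  (\int[normal_prob (0 : R) 1]_z \int[normal_prob (0 : R) 1]_z'
     (g (x + Num.sqrt q * z + Num.sqrt p * z'))%:E =
   \int[normal_prob (0 : R) 1]_z (g (x + Num.sqrt (p + q) * z))%:E)%E.
Proof.
move=> p0 q0 cg g0; have pq0 : 0 < p + q by rewrite addr_gt0.
have sp0 : 0 < Num.sqrt p by rewrite sqrtr_gt0.
have sq0 : 0 < Num.sqrt q by rewrite sqrtr_gt0.
have spq0 : 0 < Num.sqrt (p + q) by rewrite sqrtr_gt0.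
rewrite ge0_integral_gauss_affine//.
under eq_integral do rewrite ge0_integral_gauss_affine//.
pose k w y := normal_pdf y (Num.sqrt p) w.
have kE w y : k w y = normal_peak (Num.sqrt p) * normal_fun w (Num.sqrt p) y.
  by rewrite /k normal_pdfE ?gt_eqF// /normal_fun -(sqrrN (w - y)) opprB.
have ck w : continuous (k w).
  rewrite (_ : k w = normal_pdf w (Num.sqrt p)); last first.
    by apply/funext => y; rewrite kE normal_pdfE// gt_eqF.
  by apply: continuous_normal_pdf; rewrite gt_eqF.
have mg : measurable_fun [set: R] g by exact: continuous_measurable_fun.
rewrite (fubini_tonelli (m1 := normal_prob (0 : R) 1) (m2 := @lebesgue_measure R)
  (fun zw => (g zw.2 * k zw.2 (x + Num.sqrt q * zw.1))%:E))/=; first last.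
- by move=> [z w]; rewrite lee_fin mulr_ge0// normal_pdf_ge0.
- apply/measurable_EFinP; apply: measurable_funM; first exact: measurableT_comp.
  under eq_fun do rewrite kE.
  apply: measurable_funM => //; rewrite /normal_fun.
  apply: measurableT_comp => //; apply: measurable_funM => //.
  apply: measurableT_comp => //; apply: measurable_funX => //.
  apply: measurable_funB => //; apply: measurable_funD => //.
  by apply: measurable_funM.
apply: eq_integral => w _.
under eq_integral do rewrite EFinM.
rewrite ge0_integralZl//; first last.
- by rewrite lee_fin.
- by move=> z _; rewrite lee_fin normal_pdf_ge0.
- apply/measurable_EFinP; apply: continuous_measurable_fun.
  exact: (@continuous_affine R x (Num.sqrt q) (k w)).
rewrite EFinM; congr (_ * _)%E.
rewrite ge0_integral_gauss_affine//; last by move=> y; exact: normal_pdf_ge0.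
under eq_integral do rewrite normal_pdf_bridge// EFinM.
rewrite ge0_integralZl//; first last.
- by rewrite lee_fin normal_pdf_ge0.
- by move=> z _; rewrite lee_fin normal_pdf_ge0.
- by apply/measurable_EFinP; exact: measurable_normal_pdf.
by rewrite integral_normal_pdf mule1.
Qed.

(** * Lipschitz functions and Gaussian means *)

Definition lip (R : realType) (L : R) (f : R -> R) :=
  forall x y, `|f x - f y| <= L * `|x - y|.

Lemma lip_ge0 (R : realType) (L : R) (f : R -> R) : lip L f -> 0 <= L.
Proof. by move=> /(_ 1 0); rewrite subr0 normr1 mulr1; exact: le_trans. Qed.

Lemma lip_le (R : realType) (L : R) (f : R -> R) x y : lip L f ->
  f x <= f y + L * `|x - y|.
Proof. by move=> fL; rewrite -lerBlDl (le_trans (ler_norm _)). Qed.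

Lemma lip_continuous (R : realType) (L : R) (f : R -> R) :
  lip L f -> continuous f.
Proof.
move=> fL x; have L0 := lip_ge0 fL.
have L1 : 0 < L + 1 by rewrite ltr_wpDl.
apply/cvgrPdist_le => e e0; near=> y.
rewrite (le_trans (fL x y))//.
apply: (@le_trans _ _ ((L + 1) * `|x - y|)).
  by rewrite ler_wpM2r// lerDl.
rewrite mulrC -ler_pdivlMr//; near: y.
by move/cvgrPdist_le: (@cvg_id _ (nbhs x)); apply; rewrite divr_gt0.
Unshelve. all: by end_near. Qed.

Lemma lip_affine (R : realType) (L x s : R) (f : R -> R) :
  lip L f -> lip (L * `|s|) (fun z => f (x + s * z)).
Proof.
move=> fL y z; rewrite (le_trans (fL _ _))// -mulrA -normrM.
by rewrite (_ : x + s * y - (x + s * z) = s * (y - z)); [|ring].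
Qed.

Lemma lipZ (R : realType) (L m : R) (f : R -> R) :
  lip L f -> lip (`|m| * L) (fun z => m * f z).
Proof.
by move=> fL y z; rewrite -mulrBr normrM -mulrA ler_wpM2l.
Qed.

Lemma lipD (R : realType) (L M : R) (f g : R -> R) :
  lip L f -> lip M g -> lip (L + M) (fun z => f z + g z).
Proof.
move=> fL gM y z; rewrite opprD addrACA mulrDl.
by rewrite (le_trans (ler_normD _ _))// lerD.
Qed.

Lemma lip_cst (R : realType) (c : R) : lip 0 (fun _ => c).
Proof. by move=> y z; rewrite subrr normr0 mul0r. Qed.

Lemma lip_id (R : realType) : lip 1 (fun z : R => z).
Proof. by move=> y z; rewrite mul1r. Qed.

Lemma lip_norm (R : realType) (L : R) (f : R -> R) :
  lip L f -> lip L (fun z => `|f z|).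
Proof. by move=> fL y z; exact: le_trans (ler_dist_dist _ _) (fL y z). Qed.

(** A class of functions that have a Gaussian mean, large enough to contain
    Lipschitz functions and their exponentials and closed under the ring
    operations. *)
Definition subexp (R : realType) (g : R -> R) :=
  continuous g /\ exists A B : R,
    [/\ 0 <= A, 0 <= B & forall z, `|g z| <= A * expR (B * `|z|)].

Lemma subexp_cst (R : realType) (c : R) : subexp (fun _ => c).
Proof.
split; first by move=> x; exact: cvg_cst.
by exists `|c|, 0; split=> // z; rewrite mul0r expR0 mulr1.
Qed.

Lemma subexpD (R : realType) (f g : R -> R) :
  subexp f -> subexp g -> subexp (fun z => f z + g z).
Proof.
move=> [cf [A [B [A0 B0 fAB]]]] [cg [C [D [C0 D0 gCD]]]]; split.
  by move=> x; apply: cvgD; [exact: cf|exact: cg].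
exists (A + C), (B + D); split; [exact: addr_ge0..|] => z.
rewrite (le_trans (ler_normD _ _))// mulrDl lerD//.
- by rewrite (le_trans (fAB z))// ler_wpM2l// ler_expR ler_wpM2r// lerDl.
- by rewrite (le_trans (gCD z))// ler_wpM2l// ler_expR ler_wpM2r// lerDr.
Qed.

Lemma subexpM (R : realType) (f g : R -> R) :
  subexp f -> subexp g -> subexp (fun z => f z * g z).
Proof.
move=> [cf [A [B [A0 B0 fAB]]]] [cg [C [D [C0 D0 gCD]]]]; split.
  by move=> x; apply: cvgM; [exact: cf|exact: cg].
exists (A * C), (B + D); split; [exact: mulr_ge0|exact: addr_ge0|] => z.
by rewrite normrM mulrDl expRD mulrACA ler_pM.
Qed.

Lemma subexpZ (R : realType) (c : R) (f : R -> R) :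
  subexp f -> subexp (fun z => c * f z).
Proof. by apply: subexpM; exact: subexp_cst. Qed.

Lemma subexpX (R : realType) (n : nat) (f : R -> R) :
  subexp f -> subexp (fun z => f z ^+ n).
Proof.
move=> sf; elim: n => [|n IH]; first exact: subexp_cst.
by under eq_fun do rewrite exprS; exact: subexpM.
Qed.

Lemma subexp_affine (R : realType) (x s : R) (g : R -> R) :
  subexp g -> subexp (fun z => g (x + s * z)).
Proof.
move=> [cg [A [B [A0 B0 gAB]]]]; split.
  move=> z; apply: continuous_comp; last exact: cg.
  by apply: cvgD; [exact: cvg_cst|apply: cvgM; [exact: cvg_cst|exact: cvg_id]].
exists (A * expR (B * `|x|)), (B * `|s|); split; rewrite ?mulr_ge0 ?expR_ge0//.
move=> z; rewrite (le_trans (gAB _))// -mulrA ler_wpM2l// -expRD ler_expR.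
by rewrite -mulrA -mulrDr ler_wpM2l// -normrM ler_normD.
Qed.

Lemma subexp_lip (R : realType) (L : R) (f : R -> R) : lip L f -> subexp f.
Proof.
move=> fL; have L0 := lip_ge0 fL; split; first exact: lip_continuous fL.
exists (`|f 0| + 1), L; split=> // z.
apply: (@le_trans _ _ (`|f 0| + L * `|z|)).
  have := le_trans (ler_dist_dist _ _) (fL z 0); rewrite subr0.
  by move/(le_trans (ler_norm _)); rewrite lerBlDl.
rewrite mulrDl mul1r lerD//.
- by rewrite ler_peMr// (le_trans _ (expR_ge1Dx _))// lerDl mulr_ge0.
- by rewrite (le_trans _ (expR_ge1Dx _))// lerDr.
Qed.

Lemma subexp_exp_lip (R : realType) (L : R) (f : R -> R) :
  lip L f -> subexp (fun z => expR (f z)).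
Proof.
move=> fL; have L0 := lip_ge0 fL; split.
  move=> z; apply: continuous_comp; last exact: continuous_expR.
  exact: (lip_continuous fL).
exists (expR (f 0)), L; split; rewrite ?expR_ge0// => z.
rewrite ger0_norm ?expR_ge0// -expRD ler_expR.
by have := lip_le z 0 fL; rewrite subr0.
Qed.

Lemma subexp_measurable (R : realType) (g : R -> R) :
  subexp g -> measurable_fun [set: R] g.
Proof. by move=> [cg _]; exact: continuous_measurable_fun. Qed.

Lemma integral_normal_prob_cst (R : realType) (m s c : R) :
  (\int[normal_prob m s]_z c%:E = c%:E)%E.
Proof.
rewrite integral_cst//= (_ : normal_prob m s setT = 1%E) ?mule1//.
exact: probability_setT.
Qed.

Lemma subexp_integrable (R : realType) (g : R -> R) : subexp g ->
  (normal_prob (0 : R) 1).-integrable setT (EFin \o g).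
Proof.
move=> sg; have mg := subexp_measurable sg.
have iexp (c : R) : (normal_prob (0 : R) 1).-integrable setT
    (fun z => (expR (c * z))%:E).
  have mexp : measurable_fun [set: R] (fun z => expR (c * z)).
    by apply: measurableT_comp => //; exact: measurable_funM.
  apply/integrableP; split; first exact/measurable_EFinP.
  under eq_integral do rewrite gee0_abs ?lee_fin ?expR_ge0//.
  under eq_integral do rewrite -[expR _]mulr1.
  rewrite (@ge0_integral_gauss_shift R c (fun=> 1)) => [|x|//]; last exact: cvg_cst.
  by rewrite integral_normal_prob_cst mule1 ltry.
case: sg => cg [A [B [A0 B0 gAB]]].
apply: (@le_integrable _ _ _ (normal_prob (0 : R) 1) setT measurableT _
  (fun z => A%:E * ((expR (B * z))%:E + (expR (- B * z))%:E))%E) => //.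
- exact/measurable_EFinP.
- move=> z _; rewrite -EFinD -EFinM/= lee_fin (le_trans (gAB z))//.
  rewrite [leRHS]ger0_norm; last first.
    by apply: mulr_ge0 => //; apply: addr_ge0; exact: expR_ge0.
  rewrite ler_wpM2l//; have [z0|z0] := ger0P z.
  + by rewrite lerDl expR_ge0.
  + by rewrite mulrN mulNr lerDr expR_ge0.
- by apply: integrableZl => //; apply: integrableD.
Qed.

Section gaussian_mean_theory.
Variable R : realType.
Implicit Types f g : R -> R.
Local Notation gauss := (normal_prob (0 : R) 1).
Local Notation E := (@gaussian_mean R).

Lemma gaussian_meanE g : E g = fine (\int[gauss]_z (g z)%:E)%E.
Proof. by rewrite /gaussian_mean unlock. Qed.

Lemma EFin_gaussian_mean g : subexp g -> (E g)%:E = (\int[gauss]_z (g z)%:E)%E.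
Proof.
move=> sg; rewrite gaussian_meanE fineK//.
by apply: integrable_fin_num => //; exact: subexp_integrable.
Qed.

Lemma gaussian_mean_cst (c : R) : E (fun _ => c) = c.
Proof.
apply: EFin_inj; rewrite EFin_gaussian_mean ?integral_normal_prob_cst//.
exact: subexp_cst.
Qed.

Lemma gaussian_meanD f g : subexp f -> subexp g ->
  E (fun z => f z + g z) = E f + E g.
Proof.
move=> sf sg; apply: EFin_inj; rewrite EFinD !EFin_gaussian_mean//; last exact: subexpD.
under eq_integral do rewrite EFinD.
by rewrite integralD//; exact: subexp_integrable.
Qed.

Lemma gaussian_meanZ (c : R) f : subexp f -> E (fun z => c * f z) = c * E f.
Proof.
move=> sf; apply: EFin_inj; rewrite EFinM !EFin_gaussian_mean//; last exact: subexpZ.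
under eq_integral do rewrite EFinM.
by rewrite integralZl//; exact: subexp_integrable.
Qed.

Lemma gaussian_mean_le f g : subexp f -> subexp g ->
  (forall z, f z <= g z) -> E f <= E g.
Proof.
move=> sf sg fg; rewrite -lee_fin !EFin_gaussian_mean//.
apply: le_integral => //; [exact: subexp_integrable..|].
by move=> z _; rewrite lee_fin.
Qed.

Lemma gaussian_mean_shift (c : R) h :
  subexp h -> (forall z, 0 <= h z) -> subexp (fun z => h (z + c)) ->
  subexp (fun z => expR (c * z) * h z) ->
  E (fun z => expR (c * z) * h z) =
  expR (c ^+ 2 / 2) * E (fun z => h (z + c)).
Proof.
move=> sh h0 sh' sh''; apply: EFin_inj; rewrite EFinM !EFin_gaussian_mean//.
by rewrite ge0_integral_gauss_shift//; case: sh.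
Qed.

Lemma gaussian_mean_semigroup (x p q : R) g : 0 < p -> 0 < q ->
  subexp g -> (forall z, 0 <= g z) ->
  E (fun z => E (fun z' => g (x + Num.sqrt q * z + Num.sqrt p * z'))) =
  E (fun z => g (x + Num.sqrt (p + q) * z)).
Proof.
move=> p0 q0 sg g0; rewrite [RHS]gaussian_meanE -ge0_gauss_semigroup//; last by case: sg.
rewrite [LHS]gaussian_meanE; congr fine; apply: eq_integral => z _.
by rewrite EFin_gaussian_mean//; exact: subexp_affine.
Qed.

End gaussian_mean_theory.

(** * The Gaussian log-mean-exponential *)

Definition is_lip (R : realType) (f : R -> R) := exists L, lip L f.

Lemma is_lip_cst (R : realType) (c : R) : is_lip (fun _ => c).
Proof. by exists 0; exact: lip_cst. Qed.

Lemma is_lip_id (R : realType) : is_lip (fun z : R => z).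
Proof. by exists 1; exact: lip_id. Qed.

Lemma is_lipD (R : realType) (f g : R -> R) :
  is_lip f -> is_lip g -> is_lip (fun z => f z + g z).
Proof. by move=> [L fL] [M gM]; exists (L + M); exact: lipD. Qed.

Lemma is_lipZ (R : realType) (m : R) (f : R -> R) :
  is_lip f -> is_lip (fun z => m * f z).
Proof. by move=> [L fL]; exists (`|m| * L); exact: lipZ. Qed.

Lemma is_lipB (R : realType) (f g : R -> R) :
  is_lip f -> is_lip g -> is_lip (fun z => f z - g z).
Proof.
move=> fL /(is_lipZ (-1)) gL; have := is_lipD fL gL.
by under eq_fun do rewrite mulN1r.
Qed.

Lemma is_lip_affine (R : realType) (x s : R) (f : R -> R) :
  is_lip f -> is_lip (fun z => f (x + s * z)).
Proof. by move=> [L fL]; exists (L * `|s|); exact: lip_affine. Qed.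

Lemma is_lip_shift (R : realType) (c : R) (f : R -> R) :
  is_lip f -> is_lip (fun z => f (z + c)).
Proof.
by move=> /(is_lip_affine c 1); under eq_fun do rewrite mul1r addrC.
Qed.

Lemma subexp_is_lip (R : realType) (f : R -> R) : is_lip f -> subexp f.
Proof. by move=> [L]; exact: subexp_lip. Qed.

Lemma subexp_exp_is_lip (R : realType) (f : R -> R) :
  is_lip f -> subexp (fun z => expR (f z)).
Proof. by move=> [L]; exact: subexp_exp_lip. Qed.

#[local] Hint Resolve subexp_cst is_lip_cst is_lip_id is_lipD is_lipB is_lipZ
  is_lip_affine is_lip_shift subexpD subexpZ subexp_is_lip
  subexp_exp_is_lip : core.

Section log_mean.
Variable R : realType.
Implicit Types p q r g : R -> R.
Local Notation E := (@gaussian_mean R).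

(** The free energy of [g] at inverse temperature [m]; [parisi_step] is an
    instance of it. *)
Definition log_mean (m : R) g :=
  if m == 0 then E g else m^-1 * ln (E (fun z => expR (m * g z))).

Lemma gaussian_mean_expR (c : R) :
  E (fun z => expR (c * z)) = expR (c ^+ 2 / 2).
Proof.
have sc := subexp_exp_lip (lipZ c (@lip_id R)).
transitivity (E (fun z => expR (c * z) * 1)).
  by congr E; apply/funext => z; rewrite mulr1.
rewrite (@gaussian_mean_shift R c (fun=> 1))//; try exact: subexp_cst.
  by rewrite gaussian_mean_cst mulr1.
by under eq_fun do rewrite mulr1.
Qed.

Lemma gaussian_mean_id : E (fun z => z) = 0.
Proof.
have sid : subexp (fun z : R => z) := subexp_lip (@lip_id R).
have H (c : R) : c * E (fun z => z) + 1 <= expR (c ^+ 2 / 2).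
  apply: (@le_trans _ _ (E (fun z => c * z + 1))).
    by rewrite gaussian_meanD ?gaussian_meanZ ?gaussian_mean_cst; auto.
  rewrite -gaussian_mean_expR; apply: gaussian_mean_le; auto => z.
  by rewrite addrC expR_ge1Dx.
set v := E _ in H *; apply/eqP/negPn/negP => v0.
(* a small [c] of the sign of [v] contradicts the quadratic bound [H c] *)
have v2 : 0 < v ^+ 2 by rewrite exprn_even_gt0.
have D0 : 0 < 1 + v ^+ 2 by rewrite addr_gt0.
pose c := v / (1 + v ^+ 2); pose s := v ^+ 2 / (1 + v ^+ 2).
have s0 : 0 < s by rewrite divr_gt0.
have s1 : s < 1 by rewrite ltr_pdivrMr// mul1r ltrDr.
have cv : c * v = s by rewrite /c /s mulrAC expr2.
have c2 : c ^+ 2 <= s.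
  rewrite /c expr_div_n /s ler_pdivrMr ?exprn_gt0// -mulrA.
  rewrite ler_peMr ?sqr_ge0// mulrC expr2 mulfK ?gt_eqF// lerDl ltW//.
have := H c; rewrite cv; set t := c ^+ 2 / 2 => Ht.
have : expR t * (1 - t) <= 1.
  rewrite -{2}(mulfV (lt0r_neq0 (expR_gt0 t))) ler_wpM2l ?expR_ge0//.
  by rewrite -expRN; exact: expR_ge1Dx.
have t2 : 0 <= t <= s / 2 by rewrite /t divr_ge0 ?sqr_ge0//= ler_pM2r ?invr_gt0.
move: t2 => /andP[t0 ts].
have : (s + 1) * (1 - t) <= expR t * (1 - t) by rewrite ler_wpM2r//; lra.
by nra.
Qed.

(** Tangent line of the exponential at the mean. *)
Lemma gaussian_mean_jensen g : is_lip g ->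
  expR (E g) <= E (fun z => expR (g z)).
Proof.
move=> gL; apply: (@le_trans _ _ (E (fun z => expR (E g) * (1 - E g + g z)))).
  by rewrite gaussian_meanZ ?gaussian_meanD ?gaussian_mean_cst ?subrK ?mulr1; auto.
apply: gaussian_mean_le; auto => z.
rewrite -[X in _ <= expR X](subrKC (E g)) expRD ler_wpM2l ?expR_ge0//.
by rewrite -addrA (addrC (- E g)) expR_ge1Dx.
Qed.

Lemma gaussian_mean_expR_gt0 g : is_lip g -> 0 < E (fun z => expR (g z)).
Proof. by move=> /gaussian_mean_jensen; apply: lt_le_trans; exact: expR_gt0. Qed.

Lemma log_mean0 g : log_mean 0 g = E g.
Proof. by rewrite /log_mean eqxx. Qed.

Lemma expR_log_mean (m : R) g : 0 < m -> is_lip g ->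
  expR (m * log_mean m g) = E (fun z => expR (m * g z)).
Proof.
move=> m0 gL; rewrite /log_mean gt_eqF// mulrA mulfV ?gt_eqF// mul1r lnK//.
by rewrite posrE; apply: gaussian_mean_expR_gt0; auto.
Qed.

Lemma log_mean_le (m c : R) p q : 0 <= m -> is_lip p -> is_lip q ->
  (forall z, p z <= q z + c) -> log_mean m p <= log_mean m q + c.
Proof.
move=> + pL qL pq; rewrite le_eqVlt => /predU1P[<-|m0].
  rewrite !log_mean0; apply: (@le_trans _ _ (E (fun z => q z + c))).
    by apply: gaussian_mean_le; auto.
  by rewrite gaussian_meanD ?gaussian_mean_cst; auto.
rewrite -(ler_pM2l m0) -ler_expR mulrDr expRD.
rewrite (expR_log_mean m0 pL) (expR_log_mean m0 qL) mulrC.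
rewrite -gaussian_meanZ; auto; apply: gaussian_mean_le; auto => z.
by rewrite -expRD ler_expR addrC -mulrDr ler_pM2l.
Qed.

Lemma log_meanDr (m c : R) p : 0 <= m -> is_lip p ->
  log_mean m (fun z => p z + c) = log_mean m p + c.
Proof.
move=> m0 pL; apply/eqP; rewrite eq_le log_mean_le/=; auto.
by rewrite -lerBrDr log_mean_le; auto => z; rewrite addrK.
Qed.

Lemma gaussian_mean_le_log_mean (m : R) g : 0 <= m -> is_lip g ->
  E g <= log_mean m g.
Proof.
move=> + gL; rewrite le_eqVlt => /predU1P[<-|m0]; first by rewrite log_mean0.
rewrite -(ler_pM2l m0) -ler_expR (expR_log_mean m0 gL).
by rewrite -gaussian_meanZ; auto; apply: gaussian_mean_jensen; auto.
Qed.

(** Girsanov: translating the Gaussian variable by [m * c] costs the entropy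
    [m ^+ 2 * c ^+ 2 / 2]. *)
Lemma log_mean_shift (m c : R) p : 0 <= m -> is_lip p ->
  log_mean m p =
  log_mean m (fun z => p (z + m * c) - c * z) - m * c ^+ 2 / 2.
Proof.
move=> + pL; rewrite le_eqVlt => /predU1P[<-|m0].
  rewrite !log_mean0 !mul0r subr0.
  under [in RHS]eq_fun do rewrite addr0 -mulNr.
  rewrite gaussian_meanD; auto; rewrite gaussian_meanZ; auto.
  by rewrite gaussian_mean_id mulr0 addr0.
have qL : is_lip (fun z => p (z + m * c) - c * z).
  by apply: is_lipB; auto; apply: is_lip_shift.
have rL : is_lip (fun z => p z - c * z) by auto.
apply: (mulfI (lt0r_neq0 m0)); apply: expR_inj.
rewrite mulrBr expRD !expR_log_mean; auto.
pose h := fun z => expR (m * (p z - c * z)).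
transitivity (E (fun z => expR (m * c * z) * h z)).
  by congr E; apply/funext => z; rewrite -expRD; congr expR; ring.
have hE z : h (z + m * c) =
    expR (- (m * c) ^+ 2) * expR (m * (p (z + m * c) - c * z)).
  by rewrite /h -expRD; congr expR; ring.
rewrite gaussian_mean_shift.
- under eq_fun do rewrite hE.
  rewrite gaussian_meanZ; auto; rewrite mulrA -expRD mulrC; congr (_ * expR _).
  by field.
- by apply: subexp_exp_is_lip; auto.
- by move=> z; exact: expR_ge0.
- by under eq_fun do rewrite hE; auto.
- by apply: subexpM; apply: subexp_exp_is_lip; auto.
Qed.

Lemma log_mean_ge_shift (m c : R) p : 0 <= m -> is_lip p ->
  E (fun z => p (z + m * c)) - m * c ^+ 2 / 2 <= log_mean m p.
Proof.
move=> m0 pL; rewrite [leRHS](log_mean_shift c m0 pL) lerB//.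
have qL : is_lip (fun z => p (z + m * c)) by apply: is_lip_shift.
apply: (le_trans _ (gaussian_mean_le_log_mean m0 _)); last by auto.
under [in leRHS]eq_fun do rewrite -mulNr.
rewrite gaussian_meanD; auto; rewrite gaussian_meanZ; auto.
by rewrite gaussian_mean_id mulr0 addr0.
Qed.

Lemma expR_le_quadratic (s : R) : 0 <= s ->
  expR s <= 1 + s + s ^+ 2 * expR s.
Proof.
move=> s0; have e1 : expR s - 1 <= s * expR s.
  have := expR_ge1Dx (- s); rewrite expRN -(ler_pM2r (expR_gt0 s)).
  by rewrite mulVf ?lt0r_neq0 ?expR_gt0//; lra.
have := ler_wpM2l s0 e1; rewrite expr2 -mulrA; lra.
Qed.

(** For small [g] the free energy exceeds the mean only to second order; the
    weight [expR (g z)] replaces a bound on [g]. *)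
Lemma log_mean_ge0_le (m : R) g : 0 <= m <= 1 -> is_lip g ->
  (forall z, 0 <= g z) ->
  log_mean m g <= E g + E (fun z => g z ^+ 2 * expR (g z)).
Proof.
move=> /andP[+ m1] gL g0.
have sg2 : subexp (fun z => g z ^+ 2 * expR (g z)).
  by apply: subexpM; auto; apply: subexpX; auto.
rewrite le_eqVlt => /predU1P[<-|m0].
  rewrite log_mean0 lerDl -(@gaussian_mean_cst R 0).
  by apply: gaussian_mean_le; auto => z; rewrite mulr_ge0 ?sqr_ge0 ?expR_ge0.
rewrite -(ler_pM2l m0) -ler_expR (expR_log_mean m0 gL) -gaussian_meanD; auto.
pose h z := g z + g z ^+ 2 * expR (g z); have sh : subexp h by rewrite /h; auto.
rewrite -/h.
rewrite -gaussian_meanZ; auto.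
apply: (@le_trans _ _ (E (fun z => 1 + m * h z))); last first.
  by rewrite gaussian_meanD ?gaussian_mean_cst; auto; exact: expR_ge1Dx.
apply: gaussian_mean_le; auto => z.
apply: (le_trans (expR_le_quadratic (mulr_ge0 (ltW m0) (g0 z)))).
have e1 : expR (m * g z) <= expR (g z) by rewrite ler_expR ler_piMl.
have e2 : m ^+ 2 <= m by rewrite expr2 ler_piMl// ltW.
have := ler_pM (sqr_ge0 _) (expR_ge0 _) e2 e1.
move=> /(ler_wpM2l (sqr_ge0 (g z))); rewrite /h; lra.
Qed.

(** Hoelder's inequality for exponentials. *)
Lemma log_mean_convex (m al be : R) p q r : 0 <= m -> 0 <= al -> 0 <= be ->
  al + be = 1 -> is_lip p -> is_lip q -> is_lip r ->
  (forall z, r z <= al * p z + be * q z) ->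
  log_mean m r <= al * log_mean m p + be * log_mean m q.
Proof.
move=> + al0 be0 ab pL qL rL rpq; rewrite le_eqVlt => /predU1P[<-|m0].
  rewrite !log_mean0; apply: (@le_trans _ _ (E (fun z => al * p z + be * q z))).
    by apply: gaussian_mean_le; auto.
  by rewrite gaussian_meanD ?gaussian_meanZ; auto.
have [a aE] : exists a, a = log_mean m p by exists (log_mean m p).
have [b bE] : exists b, b = log_mean m q by exists (log_mean m q).
rewrite -aE -bE -(ler_pM2l m0) -ler_expR (expR_log_mean m0 rL).
have [c cE] : exists c, c = m * (al * a + be * b) by eexists.
rewrite -cE.
pose h z := al * (expR (- (m * a)) * expR (m * p z)) +
            be * (expR (- (m * b)) * expR (m * q z)).
have sp : subexp (fun z => expR (- (m * a)) * expR (m * p z)).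
  by apply/subexpZ/subexp_exp_is_lip/is_lipZ.
have sq : subexp (fun z => expR (- (m * b)) * expR (m * q z)).
  by apply/subexpZ/subexp_exp_is_lip/is_lipZ.
have sh : subexp h by apply: subexpD; exact: subexpZ.
apply: (@le_trans _ _ (E (fun z => expR c * h z))).
  apply: gaussian_mean_le; [|exact: subexpZ|move=> z; rewrite /h -!expRD].
    exact/subexp_exp_is_lip/is_lipZ.
  rewrite (_ : expR (m * r z) = expR c * expR (m * r z - c)); last first.
    by rewrite -expRD subrKC.
  rewrite ler_wpM2l ?expR_ge0//.
  apply: (@le_trans _ _ (expR (al * (- (m * a) + m * p z) + be * (- (m * b) + m * q z)))).
    by rewrite ler_expR cE; have := ler_wpM2l (ltW m0) (rpq z); lra.
  have al01 : 0 <= al <= 1 by apply/andP; split=> //; lra.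
  have := convex_expR (Itv01 al0 (proj2 (andP al01)))
    (- (m * a) + m * p z) (- (m * b) + m * q z).
  rewrite !convRE/= /unstable.onem; rewrite (_ : 1 - al = be)//; lra.
rewrite gaussian_meanZ// ler_piMr ?expR_ge0//.
rewrite /h gaussian_meanD; [|exact: subexpZ..].
rewrite !gaussian_meanZ//; try exact/subexp_exp_is_lip/is_lipZ.
rewrite -(expR_log_mean m0 pL) -(expR_log_mean m0 qL) -aE -bE -!expRD.
by rewrite !addNr expR0 !mulr1 ab.
Qed.

(** A Gaussian bound on the hyperbolic cosine: for [s ^+ 2 <= 1 / 2] from
    [expR s <= (1 - s)^-1], beyond that from [s <= 2 * s ^+ 2]. *)
Lemma expRD_expRN_le (s : R) : expR s + expR (- s) <= 2 * expR (2 * s ^+ 2).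
Proof.
wlog s0 : s / 0 <= s => [hw|].
  have [|/ltW sN] := leP 0 s; first exact: hw.
  by rewrite addrC -(sqrrN s) -{2}(opprK s); apply: hw; rewrite oppr_ge0.
have [s2|s2] := leP (s ^+ 2) (2^-1).
  have s1 : s < 1 by nra.
  have e1 : expR s <= (1 - s)^-1.
    rewrite -[leLHS]invrK -expRN lef_pV2 ?posrE ?expR_gt0 ?subr_gt0//.
    exact: expR_ge1Dx.
  have e2 : expR (- s) <= (1 + s)^-1.
    by rewrite expRN lef_pV2 ?posrE ?expR_gt0 ?expR_ge1Dx//; lra.
  apply: (le_trans (lerD e1 e2)).
  apply: (@le_trans _ _ (2 * (1 + 2 * s ^+ 2))).
    rewrite (_ : _ + _ = 2 / (1 - s ^+ 2)); last by field; nra.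
    by rewrite ler_pM2l// -[leLHS]div1r ler_pdivrMr; nra.
  by rewrite ler_pM2l// expR_ge1Dx.
have e1 : expR (- s) <= expR s by rewrite ler_expR; lra.
have : expR s <= expR (2 * s ^+ 2) by rewrite ler_expR; nra.
lra.
Qed.

Lemma expR_midpoint_le (a b : R) :
  2 * expR ((a + b) / 2) <= expR a + expR b.
Proof.
have -> : expR ((a + b) / 2) = expR (a / 2) * expR (b / 2).
  by rewrite -expRD; congr expR; lra.
have ex (w : R) : expR w = expR (w / 2) ^+ 2.
  by rewrite expr2 -expRD; congr expR; lra.
rewrite (ex a) (ex b).
have := sqr_ge0 (expR (a / 2) - expR (b / 2)); lra.
Qed.

(** The second derivative of a free energy is a mean of second derivatives plus
    [m] times a variance of slopes. Here [p] and [q] are two opposite displacements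
    of [r]: [k] bounds the former contribution, and [D ^+ 2] controls the
    variance. *)
Lemma log_mean_semiconcave (m k D : R) p q r : 0 <= m -> is_lip p ->
  is_lip q -> is_lip r -> (forall z, p z + q z <= 2 * r z + k) ->
  (forall z, `|p z - q z| <= 2 * D) ->
  log_mean m p + log_mean m q <= 2 * log_mean m r + k + 4 * m * D ^+ 2.
Proof.
move=> + pL qL rL pqr pqD; rewrite le_eqVlt => /predU1P[<-|m0].
  rewrite !log_mean0 mulr0 mul0r addr0 -gaussian_meanD; auto.
  apply: (@le_trans _ _ (E (fun z => 2 * r z + k))).
    by apply: gaussian_mean_le; auto.
  by rewrite gaussian_meanD ?gaussian_meanZ ?gaussian_mean_cst; auto.
have [a aE] : exists a, a = log_mean m p by exists (log_mean m p).
have [b bE] : exists b, b = log_mean m q by exists (log_mean m q).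
have [c cE] : exists c, c = log_mean m r by exists (log_mean m r).
rewrite -aE -bE -cE.
(* [key] bounds the arithmetic mean of [expR (m * a)] and [expR (m * b)], which
   dominates the geometric one *)
have [t tE] : exists t, t = m * k / 2 + 2 * (m * D) ^+ 2 by eexists.
have key : expR (m * a) + expR (m * b) <= 2 * expR (m * c + t).
  rewrite aE bE cE expRD !expR_log_mean; auto; rewrite -gaussian_meanD; auto.
  rewrite mulrCA mulrC -gaussian_meanZ; auto.
  apply: gaussian_mean_le; auto => z.
  set s := m * (p z - q z) / 2.
  have -> : m * p z = m * (p z + q z) / 2 + s by rewrite /s; field.
  have -> : m * q z = m * (p z + q z) / 2 - s by rewrite /s; field.
  rewrite !expRD -mulrDr.
  apply: (@le_trans _ _ (expR (m * r z + m * k / 2) * (2 * expR (2 * (m * D) ^+ 2)))).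
    apply: ler_pM; rewrite ?addr_ge0 ?expR_ge0//.
      by rewrite ler_expR; have := ler_wpM2l (ltW m0) (pqr z); lra.
    apply: (le_trans (expRD_expRN_le s)); rewrite ler_pM2l// ler_expR ler_pM2l//.
    rewrite -real_normK ?num_real// -(real_normK (num_real (m * D))).
    rewrite ler_sqr ?nnegrE// /s !normrM (gtr0_norm m0) -mulrA ler_pM2l//.
    rewrite normfV (@gtr0_norm _ 2)// ler_pdivrMr// mulrC (le_trans (pqD z))//.
    by rewrite ler_pM2l// ler_norm.
  by rewrite tE !expRD; lra.
have := le_trans (expR_midpoint_le (m * a) (m * b)) key.
rewrite ler_pM2l// ler_expR tE => H.
by rewrite -(ler_pM2l m0); lra.
Qed.

End log_mean.

(** * One step of the recursion *)

Definition line_convex (R : realType) (f : R -> R) :=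
  forall al be x y : R, 0 <= al -> 0 <= be -> al + be = 1 ->
    f (al * x + be * y) <= al * f x + be * f y.

Definition semiconcave (R : realType) (K : R) (f : R -> R) :=
  forall x y, f (x + y) + f (x - y) <= 2 * f x + K * y ^+ 2.

(** What the control bound requires of the function to which a step is applied:
    convexity provides a slope at every point, the upper bound on second
    differences makes the linearization exact to second order, and the Lipschitz
    constant bounds the control. *)
Definition regular (R : realType) (L K : R) (f : R -> R) :=
  [/\ lip L f, line_convex f & semiconcave K f].

Section step.
Variable R : realType.
Implicit Types f : R -> R.
Local Notation E := (@gaussian_mean R).

Lemma parisi_stepE (m d : R) f x :
  parisi_step m d f x = log_mean m (fun z => f (x + Num.sqrt d * z)).
Proof. by []. Qed.

Lemma parisi_step_lip (L m d : R) f : 0 <= m -> lip L f ->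
  lip L (parisi_step m d f).
Proof.
move=> m0 fL; have fl : is_lip f by exists L.
have H x y : parisi_step m d f x <= parisi_step m d f y + L * `|x - y|.
  rewrite !parisi_stepE; apply: log_mean_le; auto => z.
  have := lip_le (x + Num.sqrt d * z) (y + Num.sqrt d * z) fL.
  by rewrite opprD addrACA subrr addr0.
move=> x y; rewrite ler_norml; apply/andP; split.
- by rewrite lerNl opprB lerBlDl distrC.
- by rewrite lerBlDl.
Qed.

Lemma parisi_step_convex (m d : R) f : 0 <= m -> is_lip f ->
  line_convex f -> line_convex (parisi_step m d f).
Proof.
move=> m0 fl fC al be x y al0 be0 ab; rewrite !parisi_stepE.
apply: log_mean_convex; auto => z.
rewrite (_ : al * x + be * y + _ = al * (x + Num.sqrt d * z) + be * (y + Num.sqrt d * z)).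
  exact: fC.
rewrite -[in LHS](mul1r (Num.sqrt d * z)) -ab; ring.
Qed.

Lemma parisi_step_semiconcave (L K m d : R) f : 0 <= m <= 1 -> lip L f ->
  semiconcave K f -> semiconcave (K + 4 * L ^+ 2) (parisi_step m d f).
Proof.
move=> /andP[m0 m1] fL fK x y; have fl : is_lip f by exists L.
have L0 := lip_ge0 fL; rewrite !parisi_stepE.
apply: (le_trans (log_mean_semiconcave (r := fun z => f (x + Num.sqrt d * z))
  (k := K * y ^+ 2) (D := L * `|y|) _ _ _ _ _ _)); auto.
- by move=> z; rewrite addrAC (addrAC x (- y)); exact: fK.
- move=> z; apply: (le_trans (fL _ _)).
  rewrite (_ : _ - _ = 2 * y); last by ring.
  by rewrite normrM (@gtr0_norm _ 2)// mulrCA.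
- rewrite exprMn real_normK ?num_real//.
  have := ler_piMl (mulr_ge0 (sqr_ge0 L) (sqr_ge0 y)) m1; lra.
Qed.

(** The Lipschitz constant does not deteriorate, and the semiconcavity constant
    grows by a quantity independent of the length of the step, so that it stays
    bounded along a recursion with finitely many steps. *)
Lemma parisi_step_regular (L K m d : R) f : 0 <= m <= 1 ->
  regular L K f -> regular L (K + 4 * L ^+ 2) (parisi_step m d f).
Proof.
move=> m01 [fL fC fK]; have m0 : 0 <= m by case/andP: m01.
split; first exact: parisi_step_lip.
- by apply: parisi_step_convex => //; exists L.
- exact: parisi_step_semiconcave.
Qed.

Lemma gaussian_mean_is_lip (p : R) f : is_lip f ->
  is_lip (fun y => E (fun z => f (y + Num.sqrt p * z))).
Proof.
move=> [L fL]; exists L; have := @parisi_step_lip L 0 p f (lexx 0) fL.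
by rewrite /parisi_step eqxx.
Qed.

(** In the exponential variable [expR (m * f)] a step is a Gaussian convolution. *)
Lemma parisi_step_semigroup (m p q : R) f x : 0 <= m -> 0 < p -> 0 < q ->
  is_lip f ->
  parisi_step m q (parisi_step m p f) x = parisi_step m (p + q) f x.
Proof.
move=> + p0 q0 fl; rewrite le_eqVlt => /predU1P[<-|m0].
  rewrite /parisi_step eqxx.
  (* Tonelli's theorem is applied to the two nonnegative parts of the
     decomposition of [f] as [(f + `|f|) - `|f|] *)
  have [fnl fpl] : is_lip (fun z => `|f z|) /\ is_lip (fun z => f z + `|f z|).
    have h : is_lip (fun z => `|f z|) by case: fl => L fL; exists L; exact: lip_norm.
    by split; auto.
  have sg g : is_lip g -> (forall z, 0 <= g z) ->
      E (fun z => E (fun z' => g (x + Num.sqrt q * z + Num.sqrt p * z'))) =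
      E (fun z => g (x + Num.sqrt (p + q) * z)).
    by move=> gl g0; apply: gaussian_mean_semigroup; auto.
  have Hl g : is_lip g ->
      is_lip (fun z => E (fun z' => g (x + Num.sqrt q * z + Num.sqrt p * z'))).
    by move=> gl; exact: is_lip_affine (gaussian_mean_is_lip p gl).
  have g0 z : 0 <= f z + `|f z|.
    by rewrite -lerBlDl sub0r -normrN ler_norm.
  have := sg _ fpl g0; rewrite (gaussian_meanD (f := fun z => f _)); first last.
  - by apply: subexp_is_lip; exact: is_lip_affine fnl.
  - by auto.
  rewrite -(sg _ fnl) => [|z]; last exact: normr_ge0.
  rewrite (_ : (fun z => E _) = fun z =>
      E (fun z' => f (x + Num.sqrt q * z + Num.sqrt p * z')) +
      E (fun z' => `|f (x + Num.sqrt q * z + Num.sqrt p * z')|)); last first.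
    apply/funext => z; rewrite gaussian_meanD//; apply: subexp_is_lip.
      by auto.
    exact: is_lip_affine fnl.
  rewrite gaussian_meanD; [exact: addIr|..]; apply: subexp_is_lip.
    exact: Hl fl.
  exact: Hl fnl.
apply: (mulfI (lt0r_neq0 m0)); apply: expR_inj.
have Tl : is_lip (parisi_step m p f).
  by case: fl => L fL; exists L; apply: parisi_step_lip => //; exact: ltW.
rewrite !parisi_stepE (expR_log_mean m0 (is_lip_affine x (Num.sqrt q) Tl)).
rewrite (expR_log_mean m0 (is_lip_affine x (Num.sqrt (p + q)) fl)).
rewrite (_ : (fun z => expR _) = fun z =>
    E (fun z' => expR (m * f (x + Num.sqrt q * z + Num.sqrt p * z')))).
  apply: (@gaussian_mean_semigroup R x p q (fun y => expR (m * f y))) => //.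
  by apply: subexp_exp_is_lip; auto.
apply/funext => z; rewrite parisi_stepE.
exact: expR_log_mean m0 (is_lip_affine _ _ fl).
Qed.

(** Infimum of the right difference quotients: the right derivative. *)
Lemma convex_subgradient (L : R) f x : lip L f -> line_convex f ->
  exists u, `|u| <= L /\ forall y, f x + u * y <= f (x + y).
Proof.
move=> fL fC.
pose S := [set r | exists2 y, 0 < y & r = (f (x + y) - f x) / y].
have slope w y : 0 < w -> 0 < y -> (f x - f (x - w)) / w <= (f (x + y) - f x) / y.
  move=> w0 y0; have wy : 0 < w + y by rewrite addr_gt0.
  have wyn : w + y != 0 by rewrite gt_eqF.
  have a0 : 0 <= y / (w + y) by rewrite divr_ge0// ltW.
  have b0 : 0 <= w / (w + y) by rewrite divr_ge0// ltW.
  have ab : y / (w + y) + w / (w + y) = 1 by field.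
  have := fC _ _ (x - w) (x + y) a0 b0 ab.
  rewrite (_ : _ * (x - w) + _ = x); last by field.
  rewrite (_ : _ * f (x - w) + _ = (y * f (x - w) + w * f (x + y)) / (w + y)); last by ring.
  rewrite ler_pdivlMr// => H.
  rewrite ler_pdivrMr// mulrAC ler_pdivlMr//; lra.
have S0 : S !=set0 by exists ((f (x + 1) - f x) / 1); exists 1.
have Slb w : 0 < w -> lbound S ((f x - f (x - w)) / w).
  by move=> w0 _ [y y0 ->]; exact: slope.
have hS : has_inf S by split=> //; exists ((f x - f (x - 1)) / 1); exact: Slb.
have uS y : 0 < y -> inf S <= (f (x + y) - f x) / y.
  by move=> y0; apply: ge_inf; [case: hS|exists y].
have Su w : 0 < w -> (f x - f (x - w)) / w <= inf S.
  by move=> w0; apply: lb_le_inf => //; exact: Slb.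
have uP y : f x + inf S * y <= f (x + y).
  have [y0|y0|->] := ltgtP y 0; last by rewrite mulr0 !addr0.
  - have yN : 0 < - y by rewrite oppr_gt0.
    by have := Su _ yN; rewrite opprK ler_pdivrMr//; lra.
  - by have := uS _ y0; rewrite ler_pdivlMr//; lra.
exists (inf S); split=> //; rewrite ler_norml.
have := uP 1; have := uP (-1); rewrite mulrN !mulr1.
have := lip_le (x + 1) x fL; have := lip_le (x - 1) x fL.
rewrite addrAC subrr add0r (addrAC x) subrr add0r normrN normr1 mulr1.
by move=> h1 h2 h3 h4; apply/andP; split; lra.
Qed.

(** Any slope [u] gives a lower bound: translate the Gaussian variable, then
    apply Jensen's inequality. *)
Lemma parisi_step_lower (m d u : R) f x : 0 <= m -> 0 <= d -> is_lip f ->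
  E (fun z => f (x + m * u * d + Num.sqrt d * z)) - m * u ^+ 2 * d / 2 <=
  parisi_step m d f x.
Proof.
move=> m0 d0 fl; rewrite parisi_stepE.
have pl : is_lip (fun z => f (x + Num.sqrt d * z)) by auto.
have := log_mean_ge_shift (u * Num.sqrt d) m0 pl.
have dd : Num.sqrt d ^+ 2 = d by rewrite sqr_sqrtr.
rewrite exprMn dd mulrA; have -> : m * u * d = Num.sqrt d * (m * (u * Num.sqrt d)).
  by rewrite -{1}dd; ring.
rewrite (_ : (fun z => f _) = fun z =>
    f (x + Num.sqrt d * (m * (u * Num.sqrt d)) + Num.sqrt d * z)).
  by rewrite -(mulrA m (u ^+ 2)).
by apply/funext => z; congr f; ring.
Qed.

(** A bound, in units of [d ^+ 2], for the mean of [rho ^+ 2 * expR rho], where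
    [rho] is the remainder of the linearization of [f] at a point. At a
    displacement of length at most [sqrt d * w], where [w = `|z| + L], [rho] is
    at most [K * d * w ^+ 2] by semiconcavity and at most
    [2 * L * w] by the Lipschitz bound; the former is used in the square, the
    latter in the exponential. *)
Definition step_error (L K : R) : R :=
  E (fun z => K ^+ 2 * ((`|z| + L) ^+ 4 * expR (2 * L * (`|z| + L)))).

(** With the drift equal to the slope of [f] at [x] the control bound is sharp
    to second order in the length [d] of the step. *)
Lemma parisi_step_upper (L K m d : R) f x : 0 <= m <= 1 -> 0 < d <= 1 ->
  regular L K f -> exists2 u, `|u| <= L &
  parisi_step m d f x <=
  E (fun z => f (x + m * u * d + Num.sqrt d * z)) - m * u ^+ 2 * d / 2 +
  step_error L K * d ^+ 2.
Proof.
move=> m01 /andP[d0 d1] [fL fC fK]; have /andP[m0 m1] := m01.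
have L0 := lip_ge0 fL; have fl : is_lip f by exists L.
have [u [uL uP]] := convex_subgradient x fL fC.
exists u => //.
(* the remainder of the linearization of [f] at [x] *)
pose rho z := f (x + m * u * d + Num.sqrt d * z) - f x - u * (m * u * d + Num.sqrt d * z).
have s0 : 0 <= Num.sqrt d by exact: sqrtr_ge0.
have dd : Num.sqrt d ^+ 2 = d by rewrite sqr_sqrtr ?ltW.
have pl : is_lip (fun z => f (x + Num.sqrt d * z)) by auto.
have zl : is_lip (fun z => f (x + m * u * d + Num.sqrt d * z)) by auto.
have rl : is_lip rho.
  rewrite /rho; apply: is_lipB; first by auto.
  by apply: is_lipZ; apply: is_lipD; auto.
pose a := f x + m * u ^+ 2 * d.
have rE z : f (x + m * u * d + Num.sqrt d * z) - u * Num.sqrt d * z = rho z + a.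
  by rewrite /rho /a; ring.
have r0 z : 0 <= rho z.
  have := uP (m * u * d + Num.sqrt d * z); rewrite addrA /rho; lra.
have -> : parisi_step m d f x = log_mean m rho + a - m * u ^+ 2 * d / 2.
  rewrite parisi_stepE (log_mean_shift (u * Num.sqrt d) m0 pl).
  rewrite exprMn dd (mulrA m (u ^+ 2)) -(log_meanDr a m0 rl).
  congr (_ - _).
  congr log_mean; apply/funext => z; rewrite -rE; congr (f _ - _).
  have -> : m * u * d = Num.sqrt d * (m * (u * Num.sqrt d)).
    by rewrite -{1}dd; ring.
  by ring.
have -> : E (fun z => f (x + m * u * d + Num.sqrt d * z)) = E rho + a.
  transitivity (E (fun z => rho z + a + u * Num.sqrt d * z)).
    by congr E; apply/funext => z; rewrite -rE subrK.
  have srho : subexp rho by exact: subexp_is_lip.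
  have sid : subexp (fun z : R => z) by auto.
  rewrite gaussian_meanD; [|exact: subexpD srho (subexp_cst _)|exact: subexpZ].
  rewrite gaussian_meanZ// gaussian_mean_id mulr0 addr0.
  by rewrite gaussian_meanD ?gaussian_mean_cst.
have := log_mean_ge0_le m01 rl r0.
suff : E (fun z => rho z ^+ 2 * expR (rho z)) <= step_error L K * d ^+ 2 by lra.
have absl : is_lip (fun z : R => `|z| + L).
  by apply: is_lipD => //; exists 1; exact: lip_norm (@lip_id R).
have se : subexp (fun z => K ^+ 2 * ((`|z| + L) ^+ 4 * expR (2 * L * (`|z| + L)))).
  by apply: subexpZ; apply: subexpM; [apply: subexpX; auto|apply: subexp_exp_is_lip; auto].
rewrite /step_error mulrC -gaussian_meanZ//; apply: gaussian_mean_le.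
- by apply: subexpM; [apply: subexpX; auto|auto].
- exact: subexpZ.
move=> z; set Y := m * u * d + Num.sqrt d * z.
have rY : rho z = f (x + Y) - f x - u * Y by rewrite /rho /Y addrA.
have sd : d <= Num.sqrt d.
  by rewrite -[leLHS]dd expr2 ler_piMl// -(sqrtr1 R) ler_wsqrtr.
have s1 : Num.sqrt d <= 1 by rewrite -(sqrtr1 R) ler_wsqrtr.
have Yb : `|Y| <= Num.sqrt d * (`|z| + L).
  rewrite /Y (le_trans (ler_normD _ _))// !normrM (ger0_norm m0) (ger0_norm (ltW d0)).
  have muL : m * `|u| <= L by rewrite -[leRHS]mul1r ler_pM.
  have := ler_pM (mulr_ge0 m0 (normr_ge0 u)) (ltW d0) muL sd.
  rewrite (ger0_norm s0); lra.
have z0 : 0 <= `|z| + L by rewrite addr_ge0.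
have r1 : rho z <= 2 * L * (`|z| + L).
  apply: (@le_trans _ _ (2 * L * `|Y|)).
    rewrite rY; have := lip_le (x + Y) x fL; rewrite addrAC subrr add0r.
    have := ler_norm (- (u * Y)); rewrite normrN normrM.
    by have := ler_wpM2r (normr_ge0 Y) uL; lra.
  apply: ler_wpM2l; first by rewrite mulr_ge0.
  by rewrite (le_trans Yb)// ler_piMl.
have r2 : rho z <= K * (d * (`|z| + L) ^+ 2).
  have Y2 : Y ^+ 2 <= d * (`|z| + L) ^+ 2.
    rewrite -[X in X * _ ^+ 2]dd -exprMn -(real_normK (num_real Y)).
    by rewrite ler_sqr ?nnegrE// mulr_ge0.
  have K0 : 0 <= K.
    have := fK x 1; have := uP 1; have := uP (- 1); lra.
  apply: (@le_trans _ _ (K * Y ^+ 2)); last by rewrite ler_wpM2l.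
  have := fK x Y; have := uP (- Y); rewrite rY; lra.
rewrite (_ : _ * (_ * _) = (K * (d * (`|z| + L) ^+ 2)) ^+ 2 * expR (2 * L * (`|z| + L))).
  apply: ler_pM; rewrite ?sqr_ge0 ?expR_ge0 ?ler_expR//.
  by rewrite ler_sqr ?nnegrE// (le_trans (r0 z)).
ring.
Qed.

End step.

(** The slope [u] that is nearly optimal for [f] is an admissible control for
    [f1] and [f2]; with a common control, the drifts and the costs are averaged
    with the weights [al] and [be], exactly if [m = al * m1 + be * m2]. *)
Lemma parisi_step_joint (R : realType) (L K al be m m1 m2 d eps : R)
    (f f1 f2 : R -> R) :
  0 <= m <= 1 -> 0 <= m1 -> 0 <= m2 -> 0 < d <= 1 ->
  0 <= al -> 0 <= be -> al + be = 1 ->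
  regular L K f -> is_lip f1 -> is_lip f2 ->
  (forall x1 x2, f (al * x1 + be * x2) <= al * f1 x1 + be * f2 x2 + eps) ->
  forall x1 x2, parisi_step m d f (al * x1 + be * x2) <=
    al * parisi_step m1 d f1 x1 + be * parisi_step m2 d f2 x2 + eps +
    step_error L K * d ^+ 2 + 2 * L ^+ 2 * `|m - (al * m1 + be * m2)| * d.
Proof.
move=> m01 m10 m20 d01 al0 be0 ab fr fl1 fl2 ff x1 x2.
have [fL _ _] := fr; have L0 := lip_ge0 fL; have fl : is_lip f by exists L.
have d0 : 0 <= d by case/andP: d01 => /ltW.
have [u uL] := parisi_step_upper (al * x1 + be * x2) m01 d01 fr.
have lo1 := parisi_step_lower u x1 m10 d0 fl1.
have lo2 := parisi_step_lower u x2 m20 d0 fl2.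
have [D DE] : exists D, D = `|m - (al * m1 + be * m2)| by eexists.
rewrite -DE.
have D0 : 0 <= D by rewrite DE.
set g := fun z => f _; set g1 := fun z => f1 _ in lo1; set g2 := fun z => f2 _ in lo2.
have sg : subexp g by rewrite /g; auto.
have sg1 : subexp g1 by rewrite /g1; auto.
have sg2 : subexp g2 by rewrite /g2; auto.
have Eg : gaussian_mean g <= al * gaussian_mean g1 + be * gaussian_mean g2 +
    (eps + L ^+ 2 * D * d).
  rewrite -!gaussian_meanZ// -gaussian_meanD; [|exact: subexpZ..].
  have s12 : subexp (fun z => al * g1 z + be * g2 z) by apply: subexpD; exact: subexpZ.
  rewrite -[X in _ + X]gaussian_mean_cst -gaussian_meanD//.
  apply: gaussian_mean_le => // [|z]; first exact: subexpD.
  have := ff (x1 + m1 * u * d + Num.sqrt d * z) (x2 + m2 * u * d + Num.sqrt d * z).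
  rewrite -/(g1 z) -/(g2 z); set w := al * _ + _ => fw.
  have := lip_le (al * x1 + be * x2 + m * u * d + Num.sqrt d * z) w fL.
  rewrite -/(g z).
  suff : `|al * x1 + be * x2 + m * u * d + Num.sqrt d * z - w| <= L * D * d.
    by move=> /(ler_wpM2l L0); lra.
  have -> : al * x1 + be * x2 + m * u * d + Num.sqrt d * z - w =
      u * (m - (al * m1 + be * m2)) * d.
    by rewrite /w -[X in _ + X - _](mul1r) -ab; ring.
  by rewrite !normrM -DE (ger0_norm d0) ler_wpM2r// ler_wpM2r.
have u2 : u ^+ 2 <= L ^+ 2.
  by rewrite -(real_normK (num_real u)) ler_sqr ?nnegrE.
have Dm : (al * m1 + be * m2) - m <= D.
  by rewrite DE distrC ler_norm.
have := ler_wpM2r d0 (ler_wpM2l (sqr_ge0 u) Dm).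
have := ler_wpM2r d0 (ler_wpM2r D0 u2).
have := ler_wpM2l al0 lo1; have := ler_wpM2l be0 lo2.
have := mulr_ge0 (mulr_ge0 (sqr_ge0 L) D0) d0.
clearbody g g1 g2; lra.
Qed.

(** * Step solutions *)

Lemma finite_gap (R : realType) (n : nat) (u : nat -> R) (t : R) :
  exists2 del : R, 0 < del & forall i, (i < n)%N -> u i != t -> del <= `|u i - t|.
Proof.
elim: n => [|n [del del0 IH]]; first by exists 1.
have [unt|unt] := eqVneq (u n) t.
  exists del => // i; rewrite ltnS leq_eqVlt => /predU1P[->|]; last exact: IH.
  by rewrite unt eqxx.
exists (Num.min del `|u n - t|).
  by rewrite lt_min del0 normr_gt0 subr_eq0.
move=> i; rewrite ltnS leq_eqVlt => /predU1P[-> _|ni uit].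
  by rewrite ge_min lexx orbT.
by rewrite ge_min IH.
Qed.

Section step_decomposition_theory.
Variables (R : realType) (a : R -> R) (k : nat) (tt m : nat -> R).
Hypothesis dec : step_decomposition a k tt m.

Lemma step_decomposition_homo i j : (i <= j)%N -> (j <= k.+1)%N -> tt i <= tt j.
Proof.
have [_ _ lt_tt _] := dec.
elim: j => [|j IH]; first by rewrite leqn0 => /eqP ->.
rewrite leq_eqVlt => /predU1P[->//|]; rewrite !ltnS => ij jk.
by rewrite (le_trans (IH ij (leqW jk)))// ltW// lt_tt.
Qed.

Lemma step_decomposition_ge0 j : (j <= k.+1)%N -> 0 <= tt j.
Proof. by case: (dec) => <- _ _ _; exact: step_decomposition_homo. Qed.

Lemma step_decomposition_le1 j : (j <= k.+1)%N -> tt j <= 1.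
Proof. by case: (dec) => _ <- _ _ jk; exact: step_decomposition_homo. Qed.

Lemma step_decomposition_piece t : 0 < t <= 1 ->
  exists2 j, (j <= k)%N & tt j < t <= tt j.+1.
Proof.
have [tt0 ttk _ _] := dec => /andP[t0 t1].
have ex : exists n, t <= tt n.+1 by exists k; rewrite ttk.
case: (ex_minnP ex) => j tj jmin; exists j; first by apply: jmin; rewrite ttk.
rewrite tj andbT; case: j => [|j] in tj jmin *; first by rewrite tt0.
by rewrite ltNge; apply/negP => /jmin; rewrite ltnn.
Qed.

Lemma step_decomposition_value j : parameter_class a -> (j <= k)%N ->
  0 <= m j <= 1.
Proof.
move=> [a01 _ _] jk; have [_ _ lt_tt aE] := dec.
rewrite -(aE j jk (tt j.+1)); last by rewrite in_itv/= lt_tt ?lexx.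
have := a01 (tt j.+1); rewrite !in_itv/=; apply.
by rewrite step_decomposition_ge0 ?step_decomposition_le1.
Qed.

End step_decomposition_theory.

Lemma regular_weaken (R : realType) (L K K' : R) (f : R -> R) :
  K <= K' -> regular L K f -> regular L K' f.
Proof.
move=> KK [fL fC fK]; split=> // x y.
by rewrite (le_trans (fK x y))// lerD2l ler_wpM2r// sqr_ge0.
Qed.

(** What the recursion gives near a time [t], with no reference to the
    partition: on a short interval ending or starting at [t], the parameter is
    constant and [F] moves by a single step. *)
Definition local_flow (R : realType) (a : R -> R) (F : R -> R -> R) :=
  forall t : R, 0 <= t <= 1 -> exists2 del : R, 0 < del &
    forall s r : R, 0 <= s -> s < r -> r <= 1 -> `|s - t| < del -> `|r - t| < del ->
      s = t \/ r = t ->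
      exists m : R, [/\ 0 <= m <= 1, forall w : R, s < w <= r -> a w = m &
        forall x, F x r = parisi_step m (r - s) (F ^~ s) x].

Section step_solution_theory.
Variables (R : realType) (phi a : R -> R) (F : R -> R -> R) (L K : R).
Hypotheses (aM : parameter_class a) (aF : step_solution phi a F).
Hypothesis phir : regular L K phi.

Lemma step_solution0 x : F x 0 = phi x.
Proof. by case: aF => k [tt [m [_ ->]]]. Qed.

Lemma step_solution_regular :
  exists K', forall t : R, 0 <= t <= 1 -> regular L K' (F ^~ t).
Proof.
have [k [tt [m [dec F0 FE]]]] := aF; have [tt0 ttk lt_tt aE] := dec.
have L2 : 0 <= 4 * L ^+ 2 by rewrite mulr_ge0 ?sqr_ge0.
have FS j t : (j <= k)%N -> tt j < t <= tt j.+1 ->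
    F ^~ t = parisi_step (m j) (t - tt j) (F ^~ (tt j)).
  by move=> jk tj; apply/funext => x; apply: FE => //; rewrite in_itv.
have Fj j : (j <= k.+1)%N -> regular L (K + 4 * L ^+ 2 * j%:R) (F ^~ (tt j)).
  elim: j => [_|j IH jk].
    by rewrite tt0 mulr0 addr0 (_ : F ^~ 0 = phi)//; apply/funext.
  rewrite (FS j)//; last by rewrite lt_tt ?lexx.
  rewrite -[j.+1%:R]natr1 mulrDr mulr1 addrA; apply: parisi_step_regular.
    exact: (step_decomposition_value dec).
  exact/IH/ltnW.
exists (K + 4 * L ^+ 2 * k.+1%:R) => t /andP[].
rewrite le_eqVlt => /predU1P[<- _|t0 t1].
  rewrite -tt0; apply: regular_weaken (Fj 0%N _) => //.
  by rewrite lerD2l ler_wpM2l// ler_nat.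
have [j jk tj] : exists2 j, (j <= k)%N & tt j < t <= tt j.+1.
  by apply: (step_decomposition_piece dec); rewrite t0.
rewrite (FS j)//; have jk1 : (j <= k.+1)%N by rewrite ltnW.
apply: (regular_weaken _ (parisi_step_regular _
  (step_decomposition_value dec aM jk) (Fj j jk1))).
rewrite -addrA lerD2l -[X in _ + X]mulr1 -mulrDr natr1 ler_wpM2l// ler_nat//.
Qed.

Lemma step_solution_flow : local_flow a F.
Proof.
have [k [tt [m [dec F0 FE]]]] := aF; have [tt0 ttk lt_tt aE] := dec.
have [K' Fr] := step_solution_regular.
move=> t /andP[t0 t1]; have [del del0 gap] := finite_gap k.+2 tt t.
exists del => // s r s0 sr r1 st rt srt.
have r0 : 0 < r by exact: le_lt_trans sr.
have [j jk /andP[tj jt]] : exists2 j, (j <= k)%N & tt j < r <= tt j.+1.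
  by apply: (step_decomposition_piece dec); rewrite r0.
have jm := step_decomposition_value dec aM jk.
have tts : tt j <= s.
  (* otherwise the partition point [tt j] would lie strictly between [s] and [r],
     one of which is [t], closer to [t] than the gap allows *)
  rewrite leNgt; apply/negP => sj.
  have : tt j != t by apply/eqP => E; case: srt => E'; move: sj tj; rewrite E E' ltxx.
  move=> /(gap j (@leqW j.+1 k.+1 jk)); rewrite leNgt => /negP; apply.
  by move: st rt; rewrite !ltr_norml => /andP[? ?] /andP[? ?]; apply/andP; split; lra.
exists (m j); split=> // [w /andP[sw wr]|x].
  by apply: aE => //; rewrite in_itv/= (le_lt_trans tts)// (le_trans wr).
have FS v y : tt j < v <= r -> F y v = parisi_step (m j) (v - tt j) (F ^~ (tt j)) y.
  move=> /andP[? vr]; apply: FE => //; rewrite in_itv/=.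
  by apply/andP; split=> //; exact: le_trans jt.
move: tts; rewrite le_eqVlt => /predU1P[<-|tts]; first by rewrite FS// tj lexx.
rewrite FS; last by rewrite tj lexx.
rewrite (_ : F ^~ s = parisi_step (m j) (s - tt j) (F ^~ (tt j))); last first.
  by apply/funext => y; rewrite FS// tts ltW.
have fl : is_lip (F ^~ (tt j)).
  exists L; have [|//] := Fr (tt j).
  by rewrite (step_decomposition_ge0 dec) ?(step_decomposition_le1 dec)// ltnW.
have p0 : 0 < s - tt j by rewrite subr_gt0.
have q0 : 0 < r - s by rewrite subr_gt0.
have m0 : 0 <= m j by case/andP: jm.
rewrite (parisi_step_semigroup x m0 p0 q0 fl).
by have -> : s - tt j + (r - s) = r - tt j by ring.
Qed.

End step_solution_theory.

(** Real induction in its local form: the supremum of [Q] is attained and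
    cannot be smaller than [1]. *)
Lemma real_induction (R : realType) (Q : R -> Prop) : Q 0 ->
  (forall t : R, 0 <= t <= 1 -> exists2 del : R, 0 < del &
    forall s r : R, 0 <= s -> s < r -> r <= 1 -> `|s - t| < del -> `|r - t| < del ->
      s = t \/ r = t -> Q s -> Q r) -> Q 1.
Proof.
move=> Q0 loc; pose S := [set t | 0 <= t <= 1 /\ Q t].
have S0 : S 0 by split=> //; rewrite lexx ler01.
have Sub : ubound S 1 by move=> t [/andP[]].
have hS : has_sup S by split; [exists 0|exists 1].
have T0 : 0 <= sup S by apply: ub_le_sup => //; exists 1.
have T1 : sup S <= 1 by apply: ge_sup => //; exists 0.
have [del del0 H] := loc (sup S) (introT andP (conj T0 T1)).
have QT : Q (sup S).
  have [s [[/andP[s0 s1] Qs] sT]] := sup_adherent del0 hS.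
  have : s <= sup S by apply: ub_le_sup; [exists 1|split=> //; rewrite s0].
  rewrite le_eqVlt => /predU1P[<-//|sT'].
  apply: (H s (sup S)) => //; last by right.
  - by rewrite ltr_norml; apply/andP; split; lra.
  - by rewrite subrr normr0.
move: T1; rewrite le_eqVlt => /predU1P[<-//|T1].
pose r := Num.min 1 (sup S + del / 2).
have Tr : sup S < r by rewrite lt_min T1 ltrDl divr_gt0.
have r1 : r <= 1 by rewrite ge_min lexx.
have : Q r.
  apply: (H (sup S) r) => //; [by rewrite subrr normr0| |by left].
  have : r <= sup S + del / 2 by rewrite ge_min lexx orbT.
  by move=> ?; rewrite ltr_norml; apply/andP; split; lra.
move=> Qr; have : r <= sup S.
  by apply: ub_le_sup; [exists 1|split=> //; rewrite r1 andbT (le_trans T0)// ltW].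
by rewrite leNgt Tr.
Qed.

(** * Comparison of solutions *)

Section comparison.
Variables (R : realType) (L K al be : R).
Variables (a a1 a2 : R -> R) (F F1 F2 : R -> R -> R) (I : R -> R).
Hypotheses (al0 : 0 <= al) (be0 : 0 <= be) (ab : al + be = 1).
Hypotheses (flow : local_flow a F) (flow1 : local_flow a1 F1)
  (flow2 : local_flow a2 F2).
Hypothesis Fr : forall t, 0 <= t <= 1 -> regular L K (F ^~ t).
Hypothesis F1l : forall t, 0 <= t <= 1 -> is_lip (F1 ^~ t).
Hypothesis F2l : forall t, 0 <= t <= 1 -> is_lip (F2 ^~ t).
Hypothesis F0 : forall x1 x2,
  F (al * x1 + be * x2) 0 <= al * F1 x1 0 + be * F2 x2 0.
Hypothesis I0 : 0 <= I 0.
(* [I t] stands for the mismatch accumulated up to [t] *)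
Hypothesis Iincr : forall s r c, 0 <= s -> s < r -> r <= 1 ->
  (forall w, s < w <= r -> a w - (al * a1 w + be * a2 w) = c) ->
  I s + `|c| * (r - s) <= I r.

(** The excess of the left-hand side grows over a step of length [d] by at most
    the parameter mismatch plus [eta * d], since the second-order error of a
    short step is below any linear rate. *)
Lemma parisi_comparison x1 x2 :
  F (al * x1 + be * x2) 1 <= al * F1 x1 1 + be * F2 x2 1 + 2 * L ^+ 2 * I 1.
Proof.
have L2 : 0 <= 2 * L ^+ 2 by rewrite mulr_ge0 ?sqr_ge0.
apply/ler_addgt0Pr => eta eta0.
suff H : forall x1 x2, F (al * x1 + be * x2) 1 <=
    al * F1 x1 1 + be * F2 x2 1 + (2 * L ^+ 2 * I 1 + eta * 1).
  by have := H x1 x2; rewrite mulr1 addrA.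
pose Q t := forall x1 x2, F (al * x1 + be * x2) t <=
    al * F1 x1 t + be * F2 x2 t + (2 * L ^+ 2 * I t + eta * t).
apply: (@real_induction R Q) => [y1 y2|t t01].
  rewrite mulr0 addr0 (le_trans (F0 y1 y2))// lerDl mulr_ge0//.
have [d1 d10 H1] := flow t01; have [d2 d20 H2] := flow1 t01.
have [d3 d30 H3] := flow2 t01.
pose C := `|step_error L K| + 1.
have C0 : 0 < C by rewrite ltr_wpDl.
pose del := Num.min (Num.min d1 (Num.min d2 d3)) (Num.min 1 (eta / C)).
exists del; first by rewrite !lt_min d10 d20 d30 ltr01 divr_gt0.
move=> s r s0 sr r1; rewrite !lt_min.
move=> /andP[/and3P[s1 s2 s3] /andP[sd sC]].
move=> /andP[/and3P[r1' r2 r3] /andP[rd rC]] srt Qs.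
have [m [m01 am mF]] := H1 s r s0 sr r1 s1 r1' srt.
have [m1 [/andP[m10 _] am1 mF1]] := H2 s r s0 sr r1 s2 r2 srt.
have [m2 [/andP[m20 _] am2 mF2]] := H3 s r s0 sr r1 s3 r3 srt.
have d0 : 0 < r - s by rewrite subr_gt0.
have [dd1 ddC] : r - s < 1 /\ r - s < eta / C.
  by case: srt => E; move: sd sC rd rC; rewrite E subrr normr0 !ltr_norml =>
    *; split; lra.
have s01 : 0 <= s <= 1 by rewrite s0 (le_trans (ltW sr)).
have d01 : 0 < r - s <= 1 by rewrite d0 ltW.
move=> y1 y2.
have := parisi_step_joint m01 m10 m20 d01 al0 be0 ab (Fr s01) (F1l s01) (F2l s01) Qs y1 y2.
rewrite -mF -mF1 -mF2.
have /(ler_wpM2l L2) : I s + `|m - (al * m1 + be * m2)| * (r - s) <= I r.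
  by apply: Iincr => // w swr; rewrite am// am1// am2.
have : step_error L K * (r - s) ^+ 2 <= eta * (r - s).
  rewrite expr2 mulrA ler_wpM2r ?(ltW d0)//.
  move: ddC; rewrite ltr_pdivlMr// mulrC => ddC.
  apply: (le_trans _ (ltW ddC)); rewrite ler_wpM2r ?(ltW d0)//.
  by rewrite (le_trans (ler_norm _))// /C lerDl.
lra.
Qed.

End comparison.

Lemma parameter_class_measurable (R : realType) (a : R -> R) :
  parameter_class a -> measurable_fun (`[0, 1]%classic : set R) a.
Proof.
move=> [_ a_ni _]; pose c (x : R) := Num.max 0 (Num.min x 1).
have c01 x : c x \in `[0, 1].
  by rewrite in_itv/= /c le_max lexx/= ge_max ler01/= ge_min lexx orbT.
have : measurable_fun (`[0, 1]%classic : set R) (a \o c).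
  apply: nonincreasing_measurable => // x y xy; apply: a_ni => //.
  by rewrite /c ge_max le_max lexx/= le_max le_min !ge_min xy lexx !orbT.
apply: eq_measurable_fun => x; rewrite inE/= in_itv/= => /andP[x0 x1].
by rewrite /c min_l// max_r.
Qed.

Section L1_distance.
Variable R : realType.
Implicit Types a b c : R -> R.
Local Notation mu := (@lebesgue_measure R).

Definition L1_dist a b : R := \int[mu]_(t in `[0, 1]) `|a t - b t|.

Lemma bounded_measurable_integrable (w : R -> R) (C : R) :
  measurable_fun (`[0, 1]%classic : set R) w ->
  (forall t, 0 <= t <= 1 -> `|w t| <= C) ->
  mu.-integrable `[0, 1] (EFin \o w).
Proof.
move=> mw wC; apply: measurable_bounded_integrable => //.
  by rewrite /= lebesgue_measure_itv/= lte01 oppr0 adde0 ltry.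
exists C; split; first exact: num_real.
move=> M CM t /=; rewrite in_itv/= => t01.
by rewrite (le_trans (wC t t01))// ltW.
Qed.

Lemma parameter_class_le1 a t : parameter_class a -> 0 <= t <= 1 -> 0 <= a t <= 1.
Proof. by move=> [a01 _ _] t01; have := a01 t; rewrite !in_itv/=; apply. Qed.

Lemma L1_integrable a b : parameter_class a -> parameter_class b ->
  mu.-integrable `[0, 1] (EFin \o (fun t => `|a t - b t|)).
Proof.
move=> aM bM; apply: (@bounded_measurable_integrable _ 1).
  apply: measurableT_comp => //.
  by apply: measurable_funB; exact: parameter_class_measurable.
move=> t t01; rewrite normr_id.
have /andP[? ?] := parameter_class_le1 aM t01.
have /andP[? ?] := parameter_class_le1 bM t01.
by rewrite ler_norml; apply/andP; split; lra.
Qed.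

Lemma L1_dist_triangle a b c :
  parameter_class a -> parameter_class b -> parameter_class c ->
  L1_dist a b <= L1_dist a c + L1_dist b c.
Proof.
move=> aM bM cM; rewrite /L1_dist -RintegralD//; try exact: L1_integrable.
apply: le_Rintegral => //; first exact: L1_integrable.
  apply: (@bounded_measurable_integrable _ 2).
    apply: measurable_funD; apply: measurableT_comp => //; apply: measurable_funB;
      exact: parameter_class_measurable.
  move=> t t01; rewrite ger0_norm ?addr_ge0//.
  have /andP[? ?] := parameter_class_le1 aM t01.
  have /andP[? ?] := parameter_class_le1 bM t01.
  have /andP[? ?] := parameter_class_le1 cM t01.
  apply: (@le_trans _ _ (1 + 1)); last by lra.
  by apply: lerD; rewrite ler_norml; apply/andP; split; lra.
move=> t _; rewrite (distrC (b t)); exact: ler_distD.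
Qed.

End L1_distance.

Section step_solution_comparison.
Variables (R : realType) (phi : R -> R) (L K : R).
Hypothesis phir : regular L K phi.
Local Notation mu := (@lebesgue_measure R).

(** The case [al = 1] and [be = 0] of the comparison, with the integral of the
    mismatch. *)
Lemma step_solution_le (a b : R -> R) (F G : R -> R -> R) x :
  parameter_class a -> parameter_class b ->
  step_solution phi a F -> step_solution phi b G ->
  F x 1 <= G x 1 + 2 * L ^+ 2 * L1_dist a b.
Proof.
move=> aM bM aF bG.
have [K' Fr] := step_solution_regular aM aF phir.
have [K'' Gr] := step_solution_regular bM bG phir.
have Gl t : 0 <= t <= 1 -> is_lip (G ^~ t) by move=> /Gr[GL _ _]; exists L.
have iab := L1_integrable aM bM.
have := @parisi_comparison R L K' 1 0 a b b F G G
  (fun t => \int[mu]_(w in `[0, t]) `|a w - b w|) ler01 (lexx 0) (addr0 1)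
  (step_solution_flow aM aF phir) (step_solution_flow bM bG phir)
  (step_solution_flow bM bG phir) Fr Gl Gl _ _ _ x x.
rewrite !mul1r !mul0r !addr0; apply.
- move=> x1 x2; rewrite !mul1r !mul0r !addr0.
  by rewrite (step_solution0 aF) (step_solution0 bG).
- exact: Rintegral_ge0.
move=> s r c s0 sr r1 Hc.
have ss : `[0, r] `<=` (`[0, 1] : set R).
  by move=> t/=; rewrite !in_itv/= => /andP[-> tr]; rewrite (le_trans tr).
have U : (`[0, r]%classic : set R) = `[0, s] `|` `]s, r].
  by rewrite -itv_bndbnd_setU// bnd_simp// ltW.
rewrite U Rintegral_setU//.
- rewrite lerD2l [leRHS](_ : _ = \int[mu]_(w in `]s, r]) `|c|).
    by rewrite Rintegral_cst//= lebesgue_measure_itv/= lte_fin sr.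
  apply: eq_Rintegral => w; rewrite inE/= in_itv/= => swr.
  by rewrite -(Hc w swr) mul1r mul0r addr0.
- by rewrite -U; exact: integrableS iab.
- rewrite disj_set2E; apply/eqP/seteqP; split=> // w [] /=.
  by rewrite !in_itv/= => /andP[_ ws] /andP[]; rewrite ltNge ws.
Qed.

Lemma step_solution_dist (a b : R -> R) (F G : R -> R -> R) x :
  parameter_class a -> parameter_class b ->
  step_solution phi a F -> step_solution phi b G ->
  `|F x 1 - G x 1| <= 2 * L ^+ 2 * L1_dist a b.
Proof.
move=> aM bM aF bG; have sym : L1_dist b a = L1_dist a b.
  by apply: eq_Rintegral => t _; rewrite distrC.
have := step_solution_le x bM aM bG aF; rewrite sym.
have := step_solution_le x aM bM aF bG.
by move=> h1 h2; rewrite ler_norml; apply/andP; split; lra.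
Qed.

(** The parameter [a] being exactly the mixture, there is no mismatch to
    accumulate. *)
Lemma step_solution_joint_convex (al be : R) (a a1 a2 : R -> R)
    (F F1 F2 : R -> R -> R) x1 x2 :
  0 <= al -> 0 <= be -> al + be = 1 ->
  parameter_class a -> parameter_class a1 -> parameter_class a2 ->
  (forall t, 0 < t <= 1 -> a t = al * a1 t + be * a2 t) ->
  step_solution phi a F -> step_solution phi a1 F1 ->
  step_solution phi a2 F2 ->
  F (al * x1 + be * x2) 1 <= al * F1 x1 1 + be * F2 x2 1.
Proof.
move=> al0 be0 ab aM a1M a2M aE aF a1F a2F.
have [K0 Fr] := step_solution_regular aM aF phir.
have [K1 F1r] := step_solution_regular a1M a1F phir.
have [K2 F2r] := step_solution_regular a2M a2F phir.
have F1l t : 0 <= t <= 1 -> is_lip (F1 ^~ t) by move=> /F1r[h _ _]; exists L.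
have F2l t : 0 <= t <= 1 -> is_lip (F2 ^~ t) by move=> /F2r[h _ _]; exists L.
have := @parisi_comparison R L K0 al be a a1 a2 F F1 F2 (fun=> 0) al0 be0 ab
  (step_solution_flow aM aF phir) (step_solution_flow a1M a1F phir)
  (step_solution_flow a2M a2F phir) Fr F1l F2l _ (lexx 0) _ x1 x2.
rewrite mulr0 addr0; apply.
- move=> y1 y2; rewrite (step_solution0 aF) (step_solution0 a1F).
  by rewrite (step_solution0 a2F); case: phir => _ + _; apply.
move=> s r c s0 sr r1 Hc.
have <- := Hc r; last by rewrite sr lexx.
by rewrite -aE ?subrr ?normr0 ?mul0r ?addr0// r1 andbT (le_lt_trans s0).
Qed.

End step_solution_comparison.

(** * Approximation by step functions and passage to the limit *)

Section grid.
Variable R : realType.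
Implicit Types (n : nat) (a : R -> R) (s t : R).

(** The last point strictly before [t] of the grid of mesh [1 / n.+1] (and [0]
    for [t = 0]): evaluating there turns left-continuity into pointwise
    convergence of the step approximations. *)
Definition grid_point n t : R :=
  Num.max 0 (((Num.ceil (n.+1%:R * t))%:~R - 1) / n.+1%:R).

Lemma grid_point_ge0 n t : 0 <= grid_point n t.
Proof. by rewrite le_max lexx. Qed.

Lemma grid_point_lt n t : 0 < t -> grid_point n t < t.
Proof.
move=> t0; rewrite gt_max t0 ltr_pdivrMr ?ltr0n// [ltRHS]mulrC.
by have /andP[+ _] := ceil_itv (n.+1%:R * t); rewrite intrB.
Qed.

Lemma grid_point_ge n t : t - n.+1%:R^-1 <= grid_point n t.
Proof.
rewrite le_max; apply/orP; right.
rewrite mulrDl mulN1r lerD2r ler_pdivlMr ?ltr0n// [leLHS]mulrC.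
exact: ceil_ge.
Qed.

Lemma grid_point0 n : grid_point n 0 = 0.
Proof.
by rewrite /grid_point mulr0 ceil0 sub0r mulN1r max_l// oppr_le0 invr_ge0 ler0n.
Qed.

Lemma grid_point_le n t : 0 <= t -> grid_point n t <= t.
Proof.
rewrite le_eqVlt => /predU1P[<-|/(grid_point_lt n)/ltW//].
by rewrite grid_point0.
Qed.

Lemma grid_point_homo n s t : s <= t -> grid_point n s <= grid_point n t.
Proof.
move=> st; rewrite /grid_point ge_max le_max lexx/= le_max; apply/orP; right.
rewrite ler_pM2r ?invr_gt0 ?ltr0n// lerD2r ler_int le_ceil//.
by rewrite ler_pM2l ?ltr0n.
Qed.

Lemma grid_point_const n s t : grid_point n t < s <= t ->
  grid_point n s = grid_point n t.
Proof.
move=> /andP[]; rewrite {1}/grid_point gt_max => /andP[s0].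
rewrite ltr_pdivrMr ?ltr0n// [ltRHS]mulrC => cs st.
rewrite /grid_point (@ceil_def _ _ (Num.ceil (n.+1%:R * t)))//.
rewrite intrB cs/= (le_trans _ (ceil_ge _))//.
by rewrite ler_pM2l ?ltr0n.
Qed.

Lemma ceil_grid n j t : j%:R / n.+1%:R < t <= j.+1%:R / n.+1%:R ->
  Num.ceil (n.+1%:R * t) = j.+1%:Z.
Proof.
rewrite ltr_pdivrMr ?ltr0n// ler_pdivlMr ?ltr0n// (mulrC t) => /andP[h1 h2].
apply: ceil_def; rewrite -[(j.+1%:Z)%:~R]/(j.+1%:R) h2 andbT.
by rewrite intrB -[(j.+1%:Z)%:~R]/(j.+1%:R) -natr1 addrK.
Qed.

Lemma grid_point_piece n j t : j%:R / n.+1%:R < t <= j.+1%:R / n.+1%:R ->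
  grid_point n t = j%:R / n.+1%:R.
Proof.
move=> /ceil_grid; rewrite /grid_point => ->.
by rewrite -[(j.+1%:Z)%:~R]/(j.+1%:R) -natr1 addrK max_r// divr_ge0 ?ler0n.
Qed.

Lemma grid_point_cvg t : 0 <= t -> grid_point n t @[n --> \oo] --> t.
Proof.
move=> t0; apply: (@squeeze_cvgr _ _ _ _ (fun n => t - n.+1%:R^-1) (cst t)).
- by near=> n; rewrite grid_point_ge grid_point_le.
- rewrite -[X in _ --> X]subr0; apply: cvgB; first exact: cvg_cst.
  exact: cvg_harmonic.
- exact: cvg_cst.
Unshelve. all: by end_near. Qed.

Definition grid_step n a t := a (grid_point n t).

Lemma grid_step_parameter n a : parameter_class a -> parameter_class (grid_step n a).
Proof.
move=> aM; have [a01 a_ni _] := aM.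
have g01 t : t \in `[0, 1] -> grid_point n t \in `[0, 1].
  rewrite !in_itv/= => /andP[t0 t1].
  by rewrite grid_point_ge0 (le_trans (grid_point_le n t0)).
split=> [t /g01/a01//|s t s01 t01 st|t].
  by apply: a_ni; [exact: g01..|exact: grid_point_homo].
rewrite in_itv/= => /andP[t0 t1]; apply: cvg_near_cst.
near=> s; rewrite /grid_step (@grid_point_const n s t)//; apply/andP; split.
  near: s; apply: nbhs_left_gt; exact: grid_point_lt.
by near: s; exact: nbhs_left_le.
Unshelve. all: by end_near. Qed.

Lemma grid_step_value n a j t :
  j%:R / n.+1%:R < t <= j.+1%:R / n.+1%:R -> grid_step n a t = a (j%:R / n.+1%:R).
Proof. by move=> /grid_point_piece; rewrite /grid_step => ->. Qed.

Lemma grid_step_solution n (phi a : R -> R) :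
  exists F, step_solution phi (grid_step n a) F.
Proof.
pose tt j : R := j%:R / n.+1%:R; pose m j := a (tt j).
pose G := fix G j := if j is i.+1 then parisi_step (m i) (tt i.+1 - tt i) (G i)
                     else phi.
pose F x t := if t <= 0 then phi x else
  let j := `|Num.ceil (n.+1%:R * t) - 1|%N in parisi_step (m j) (t - tt j) (G j) x.
have tt_ge0 j : 0 <= tt j by rewrite divr_ge0 ?ler0n.
have FS j x t : tt j < t <= tt j.+1 -> F x t = parisi_step (m j) (t - tt j) (G j) x.
  move=> jt; rewrite /F leNgt (le_lt_trans (tt_ge0 j)) ?(andP jt).1//=.
  by rewrite (ceil_grid jt) -addn1 PoszD addrK absz_nat.
have FG j : F ^~ (tt j) = G j.
  apply/funext => x; case: j => [|j]; first by rewrite /F /tt mul0r lexx.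
  by rewrite (FS j)// lexx andbT ltr_pM2r ?invr_gt0 ?ltr0n// ltr_nat.
exists F, n, tt, m; split.
- split.
  + by rewrite /tt mul0r.
  + by rewrite /tt divff// pnatr_eq0.
  + by move=> j _; rewrite ltr_pM2r ?invr_gt0 ?ltr0n// ltr_nat.
  + by move=> j _ t; rewrite in_itv/=; exact: grid_step_value.
- by move=> x; rewrite /F lexx.
- by move=> j _ t; rewrite in_itv/= => jt x; rewrite FG; exact: FS.
Qed.

Lemma grid_step_L1_cvg a : parameter_class a -> L1_cvg (grid_step ^~ a) a.
Proof.
move=> aM; have [_ _ a_lc] := aM.
have i1 : (@lebesgue_measure R).-integrable `[0, 1] (EFin \o (fun=> 1 : R)).
  by apply: (@bounded_measurable_integrable _ _ 1) => // t _; rewrite normr1.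
have [||||_ + _] := @dominated_convergence _ _ R (@lebesgue_measure R) `[0, 1]
  (measurable_itv _) (fun n => EFin \o grid_step n a) (EFin \o a)
  (EFin \o (fun=> 1)) _ _ _ i1 _.
- move=> n; apply/measurable_EFinP.
  by apply: parameter_class_measurable; exact: grid_step_parameter.
- by apply/measurable_EFinP; exact: parameter_class_measurable.
- apply/aeW => t /=; rewrite in_itv/= => /andP[t0 t1].
  apply: cvg_EFin; first by near=> n.
  move: t0; rewrite le_eqVlt => /predU1P[<-|t0].
    by apply: cvg_near_cst; near=> n; rewrite /= /grid_step grid_point0.
  have t01 : t \in `]0, 1] by rewrite in_itv/= t0.
  have /cvg_at_leftP := a_lc t t01.
  move=> /(_ (fun n => grid_point n t)); apply; split.
    by move=> n; exact: grid_point_lt.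
  exact/grid_point_cvg/ltW.
- apply/aeW => t n /=; rewrite in_itv/= lee_fin => t01.
  have /andP[? ?] := parameter_class_le1 (grid_step_parameter n aM) t01.
  by rewrite ger0_norm.
- by [].
Unshelve. all: by end_near. Qed.

End grid.

Section limit.
Variables (R : realType) (phi : R -> R) (L K : R).
Hypothesis phir : regular L K phi.

Lemma L1_dist_cvg (a : R -> R) (b : nat -> R -> R) :
  L1_cvg b a -> L1_dist (b n) a @[n --> \oo] --> 0.
Proof. exact: fine_cvg. Qed.

(** The values along the grid approximations form a Cauchy sequence by the
    Lipschitz bound, which also forces any other approximating sequence to the
    same limit. *)
Lemma parisi_limit_exists (a : R -> R) x : parameter_class a ->
  exists l, parisi_limit phi a x 1 l.
Proof.
move=> aM.
have /choice[F FS] n : exists F, step_solution phi (grid_step n a) F.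
  exact: grid_step_solution.
have gM n := grid_step_parameter n aM.
have g0 := L1_dist_cvg (grid_step_L1_cvg aM).
have c0 : 0 < 2 * L ^+ 2 + 1 by rewrite ltr_wpDl// mulr_ge0 ?sqr_ge0.
have dist (b1 b2 : R -> R) G1 G2 : parameter_class b1 -> parameter_class b2 ->
    step_solution phi b1 G1 -> step_solution phi b2 G2 ->
    `|G1 x 1 - G2 x 1| <= (2 * L ^+ 2 + 1) * (L1_dist b1 a + L1_dist b2 a).
  move=> b1M b2M G1S G2S; apply: (le_trans (step_solution_dist phir x b1M b2M G1S G2S)).
  have tri := L1_dist_triangle b1M b2M aM.
  have b120 : 0 <= L1_dist b1 b2 by apply: Rintegral_ge0.
  by apply: ler_pM => //; rewrite ?lerDl// mulr_ge0// sqr_ge0.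
have /cauchy_cvgP/cvg_ex[l Fl] : cauchy (F n x 1 @[n --> \oo]).
  apply: cauchy_exP => e e0.
  have ec : 0 < e / (2 * L ^+ 2 + 1) / 2 by rewrite !divr_gt0.
  have /cvgrPdist_lt /(_ _ ec) [N _ HN] := g0.
  exists (F N x 1); exists N => // n /= Nn; rewrite -ball_normE /=.
  apply: (le_lt_trans (dist _ _ _ _ (gM N) (gM n) (FS N) (FS n))).
  have small k : (N <= k)%N ->
      L1_dist (grid_step k a) a < e / (2 * L ^+ 2 + 1) / 2.
    move=> /HN /=; rewrite sub0r normrN; exact: le_lt_trans (ler_norm _).
  rewrite mulrC -ltr_pdivlMr// [ltRHS]splitr.
  by rewrite ltrD// small.
exists l => b G bM GS ba; have b0 := L1_dist_cvg ba.
pose c n := (2 * L ^+ 2 + 1) * (L1_dist (b n) a + L1_dist (grid_step n a) a).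
have cc : c n @[n --> \oo] --> 0.
  have : c n @[n --> \oo] --> (2 * L ^+ 2 + 1) * (0 + 0).
    by apply: cvgM; [exact: cvg_cst|exact: cvgD].
  by rewrite addr0 mulr0.
have d0 : (G n x 1 - F n x 1) @[n --> \oo] --> 0.
  apply: (@squeeze_cvgr _ _ _ _ (fun n => - c n) c) => //.
    by near=> n; rewrite -ler_norml; exact: dist.
  by rewrite -oppr0; exact: cvgN.
rewrite -(addr0 l).
rewrite (_ : (fun n => G n x 1) = fun n => F n x 1 + (G n x 1 - F n x 1)).
  exact: cvgD.
by apply/funext => n; rewrite subrKC.
Unshelve. all: by end_near. Qed.

Lemma parisi_functional_limit (a : R -> R) x : parameter_class a ->
  parisi_limit phi a x 1 (parisi_functional phi x a).
Proof. by move=> /(parisi_limit_exists x) /getPex. Qed.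

Lemma parisi_functional_convex (a1 a2 : R -> R) (al be : R) x1 x2 :
  0 <= al -> 0 <= be -> al + be = 1 ->
  parameter_class a1 -> parameter_class a2 ->
  parisi_functional phi (al * x1 + be * x2) (fun t => al * a1 t + be * a2 t) <=
  al * parisi_functional phi x1 a1 + be * parisi_functional phi x2 a2.
Proof.
move=> al0 be0 ab a1M a2M; set a := fun t => _.
have aM : parameter_class a.
  have [h1 h2 h3] := a1M; have [k1 k2 k3] := a2M; split.
  - move=> t t01; have := h1 t t01; have := k1 t t01; rewrite !in_itv/=.
    move=> /andP[p1 p2] /andP[q1 q2]; apply/andP; split.
      by rewrite addr_ge0// mulr_ge0.
    by rewrite -ab lerD// ler_piMr.
  - move=> s t s01 t01 st; apply: lerD.
      by rewrite ler_wpM2l// h2.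
    by rewrite ler_wpM2l// k2.
  - move=> t t01; apply: cvgD; apply: cvgM; try exact: cvg_cst.
      exact: h3.
    exact: k3.
have sol b n : exists F, step_solution phi (grid_step n b) F.
  exact: grid_step_solution.
have /choice[F FS] := sol a; have /choice[F1 F1S] := sol a1.
have /choice[F2 F2S] := sol a2.
have lim b (bM : parameter_class b) G x :
    (forall n, step_solution phi (grid_step n b) (G n)) ->
    G n x 1 @[n --> \oo] --> parisi_functional phi x b.
  move=> GS; have := @parisi_functional_limit b x bM.
  move=> /(_ (fun n => grid_step n b) G); apply=> // [n|].
    exact: grid_step_parameter.
  exact: grid_step_L1_cvg.
have l1 := lim a1 a1M F1 x1 F1S; have l2 := lim a2 a2M F2 x2 F2S.
apply: (ler_cvg_to (lim a aM F _ FS)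
  (cvgD (cvgM (cvg_cst al) l1) (cvgM (cvg_cst be) l2))).
near=> n; apply: (step_solution_joint_convex phir x1 x2 al0 be0 ab
  _ _ _ _ (FS n) (F1S n) (F2S n)).
- exact: grid_step_parameter.
- exact: grid_step_parameter.
- exact: grid_step_parameter.
- by [].
Unshelve. all: by end_near. Qed.

End limit.

Section initial_condition.
Variable R : realType.
Implicit Types f : R -> R.

Lemma derivable_mean_value f (x y : R) : (forall z, derivable f z 1) -> x < y ->
  exists2 z, x < z < y & f y - f x = derive1 f z * (y - x).
Proof.
move=> df xy; have [||z zxy E] := @MVT R f (derive1 f) x y xy.
- by move=> z _; rewrite derive1E; exact: derivableP.
- apply: continuous_subspaceT => z.
  exact/differentiable_continuous/derivable1_diffP.
by exists z => //; move: zxy; rewrite in_itv.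
Qed.

Lemma derivable_lip f (L : R) : (forall z, derivable f z 1) ->
  (forall z, `|derive1 f z| <= L) -> lip L f.
Proof.
move=> df fL x y; wlog xy : x y / x <= y.
  move=> hw; have [|/ltW] := leP x y; first exact: hw.
  by rewrite distrC (distrC x); exact: hw.
move: xy; rewrite le_eqVlt => /predU1P[<-|xy]; first by rewrite !subrr normr0 mulr0.
have [z _ E] := derivable_mean_value df xy.
by rewrite distrC E normrM (distrC x) ler_wpM2r.
Qed.

(** The two difference quotients on the sides of [x] are slopes at points at most
    [2 * y] apart. *)
Lemma lip_derivative_semiconcave f (K : R) : (forall z, derivable f z 1) ->
  lip K (derive1 f) -> semiconcave (2 * K) f.
Proof.
move=> df fK x y; have K0 := lip_ge0 fK; wlog y0 : y / 0 <= y.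
  move=> hw; have [|/ltW yN] := leP 0 y; first exact: hw.
  have := hw (- y); rewrite oppr_ge0 opprK sqrrN addrC; exact.
move: y0; rewrite le_eqVlt => /predU1P[<-|y0].
  by rewrite subr0 addr0 expr0n/= mulr0 addr0 mulr2n mulrDl mul1r.
have [|z1 /andP[z11 z12] E1] := derivable_mean_value df (_ : x < x + y).
  by rewrite ltrDl.
have [|z2 /andP[z21 z22] E2] := derivable_mean_value df (_ : x - y < x).
  by rewrite ltrBlDr ltrDl.
have H : derive1 f z1 - derive1 f z2 <= K * (2 * y).
  apply: (le_trans (ler_norm _)); apply: (le_trans (fK _ _)).
  by rewrite ler_wpM2l// ler_norml; apply/andP; split; lra.
have := ler_wpM2r (ltW y0) H; move: E1 E2.
rewrite addrAC subrr add0r opprB addrCA subrr addr0 expr2; lra.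
Qed.

Lemma bounded_setT_ex f : [bounded f x | x in setT] ->
  exists M : R, forall x, `|f x| <= M.
Proof.
move=> [M [_ HM]]; exists (M + 1) => x.
by apply: HM => //; rewrite ltrDl.
Qed.

Lemma initial_class_regular (phi : R -> R) : initial_class phi ->
  convex_function (setT : set R) phi -> exists L K, regular L K phi.
Proof.
move=> [d1 d2 /bounded_setT_ex[L HL] /bounded_setT_ex[K HK]] phi_cvx.
exists L, (2 * K); split.
- exact: derivable_lip.
- move=> al be x y al0 be0 ab; have al1 : al <= 1 by rewrite -ab lerDl.
  have <- : 1 - al = be by rewrite -ab addrAC subrr add0r.
  exact: (phi_cvx (Itv01 al0 al1) x y (mem_set I) (mem_set I)).
- by apply: lip_derivative_semiconcave => //; exact: derivable_lip.
Qed.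

End initial_condition.

Theorem corollary1 (R : realType) (phi : R -> R)
  (phiC : initial_class phi)
  (phi_shape :
    ((forall x y : R, x <= y -> phi x <= phi y) /\
      convex_function (setT : set R) phi) \/
    ((forall x : R, phi (- x) = phi x) /\
      convex_function (setT : set R) phi))
  (x : R) (a1 a2 : R -> R)
  (a1M : parameter_class a1) (a2M : parameter_class a2)
  (a12 : forall t, t \in `[0, 1] -> a1 t <= a2 t)
  (alpha : R) (alpha01 : 0 <= alpha <= 1) :
  parisi_functional phi x (fun t => alpha * a1 t + (1 - alpha) * a2 t) <=
  alpha * parisi_functional phi x a1 +
  (1 - alpha) * parisi_functional phi x a2.
Proof.
have phi_cvx : convex_function (setT : set R) phi by case: phi_shape => -[].
have [L [K phir]] := initial_class_regular phiC phi_cvx.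
have /andP[al0 al1] := alpha01.
have be0 : 0 <= 1 - alpha by rewrite subr_ge0.
have ab : alpha + (1 - alpha) = 1 by rewrite subrKC.
have := parisi_functional_convex phir x x al0 be0 ab a1M a2M.
by rewrite -mulrDl ab mul1r.
Qed.
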